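(* Let $(A,\mathcal D,\psi)$ be a weak entwining structure over $k$ and let $\mathcal C$ be the associated $A$-coring. Then $(A,\mathcal D,\psi)$ is cleft if and only if $A$ (with the right regular $A$-module structure) is a weak cleft bicomodule for the pure right coring extension $\mathcal D$ of $\mathcal C$.
   Context: Fix a commutative ring $k$; all algebras are associative unital $k$-algebras; unadorned $\otimes$ is over $k$. Weak entwining structures. A weak entwining structure consists of a $k$-algebra $A$, a $k$-coalgebra $\mathcal D$ (coproduct $d\mapsto d_{(1)}\otimes d_{(2)}$, counit $\epsilon_{\mathcal D}$) and a $k$-linear map $\psi:\mathcal D\otimes A\to A\otimes\mathcal D$, $d\otimes a\mapsto a_\psi\otimes d^\psi$ (implicit summation), with $\psi\circ(\mathcal D\otimes\mu_A)=(\mu_A\otimes\mathcal D)(A\otimes\psi)(\psi\otimes A)$, $(A\otimes\Delta_{\mathcal D})\circ\psi=(\psi\otimes\mathcal D)(\mathcal D\otimes\psi)(\Delta_{\mathcal D}\otimes A)$, and, for $e:=(A\otimes\epsilon_{\mathcal D})\circ\psi\circ(\mathcal D\otimes1_A):\mathcal D\to A$, $\psi(d\otimes1_A)=e(d_{(1)})\otimes d_{(2)}$ and $(A\otimes\epsilon_{\mathcal D})\psi(d\otimes a)=e(d)a$. The associated $A$-coring is $\mathcal C=\{a1_{A\psi}\otimes d^\psi\}_{a\otimes d\in A\otimes\mathcal D}$ (the $k$-submodule of $A\otimes\mathcal D$ which is the range of $a\otimes d\mapsto a1_{A\psi}\otimes d^\psi$), with left multiplication, right action $(a1_{A\psi}\otimes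 d^\psi)a'=aa'_\psi\otimes d^\psi$, coproduct the restriction of $A\otimes\Delta_{\mathcal D}$, i.e. $a1_{A\psi}\otimes d^\psi\mapsto(a1_{A\psi}\otimes{d_{(1)}}^\psi)\otimes_A(1_{A\psi'}\otimes{d_{(2)}}^{\psi'})$, and counit $a1_{A\psi}\otimes d^\psi\mapsto ae(d)$. The $k$-coring $\mathcal D$ is a pure right extension of $\mathcal C$ via the right $\mathcal D$-coaction $\tau_{\mathcal C}:a1_{A\psi}\otimes d^\psi\mapsto(a1_{A\psi}\otimes{d_{(1)}}^\psi)\otimes d_{(2)}$ (restriction of $A\otimes\Delta_{\mathcal D}$). Right $\mathcal C$-comodules are the same as weak entwined modules: right $A$-modules and right $\mathcal D$-comodules $M$ (coaction $m\mapsto m_{[0]}\otimes m_{[1]}$) with $(ma)_{[0]}\otimes(ma)_{[1]}=m_{[0]}a_\psi\otimes{m_{[1]}}^\psi$. Cleft weak entwining structures. $(A,\mathcal D,\psi)$ is cleft if $A$, with the right regular $A$-module structure, is a weak entwined module (i.e. carries a right $\mathcal D$-coaction making it so) and there exist a right $\mathcal D$-colinear map $\lambda:\mathcal D\to A$ and a $k$-linear map $\bar\lambda:\mathcal D\to A$ such that for all $d\in\mathcal D$: $\bar\lambda(d)1_{A[0]}\otimes1_{A[1]}=\bar\lambda(d_{(2)})_\psi\otimes{d_{(1)}}^\psi$, $1_{A\psi}\bar\lambda(d^\psi)=\bar\lambda(d)$ and $\bar\lambda(d_{(1)})\lambda(d_{(2)})=e(d)$. Weak cleft bicomodules. Let $\mathcal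 C$ be any $A$-coring (coproduct $c\mapsto c^{(1)}\otimes_Ac^{(2)}$, right coactions $m\mapsto m^{[0]}\otimes_Am^{[1]}$) having the $k$-coalgebra $\mathcal D$ as a pure right extension with left $\mathcal C$-colinear coaction $c\mapsto c_{[0]}\otimes c_{[1]}$; then any right $\mathcal C$-comodule $M$ is a right $\mathcal D$-comodule via $m\mapsto m^{[0]}\epsilon_{\mathcal C}({m^{[1]}}_{[0]})\otimes{m^{[1]}}_{[1]}$. For a right $\mathcal C$-comodule $\Sigma$ put $\Sigma^*=\mathrm{Hom}_A(\Sigma,A)$ and $$\widetilde Q=\{q\in{}_A\mathrm{Hom}(\mathcal C,\Sigma^* )\mid c^{(1)}q(c^{(2)})(x)=q(c)(x^{[0]})x^{[1]}\ \forall x\in\Sigma,c\in\mathcal C\}.$$ For $p\in\mathrm{Hom}^{\mathcal D}(\mathcal D,\Sigma)$ and $q\in\widetilde Q$ put $(q\bullet p)(c)=q(c_{[0]})\big(p(c_{[1]})^{[0]}\big)p(c_{[1]})^{[1]}$. $\Sigma$ is a weak cleft bicomodule for the extension if there exist $j\in\mathrm{Hom}^{\mathcal D}(\mathcal D,\Sigma)$, $\tilde\jmath\in\widetilde Q$ with $\tilde\jmath\bullet j=\mathrm{id}_{\mathcal C}$. That ''$A$ (with the right regular $A$-module structure) is a weak cleft bicomodule'' means that the right regular $A$-module $A$ carries a right $\mathcal C$-coaction for which it is weak cleft; the coaction is the same on both sides of the equivalence. *)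

(* Defs.v *)
From HB Require Import structures.
From mathcomp Require Import all_boot all_algebra.
From mathcomp Require Import boolp.

Set Implicit Arguments.
Unset Strict Implicit.
Unset Printing Implicit Defensive.

Import GRing.Theory.
Local Open Scope ring_scope.
Local Open Scope quotient_scope.

(* Unital associative k-algebras, A = 0 allowed (algType requires 1 != 0). *)
Record kalg (k : comPzRingType) := KAlg {
  kalg_mod : lmodType k;
  kalg_one : kalg_mod;
  kalg_mul : kalg_mod -> kalg_mod -> kalg_mod;
  kalg_mulA : associative kalg_mul;
  kalg_mul1l : left_id kalg_one kalg_mul;
  kalg_mul1r : right_id kalg_one kalg_mul;
  kalg_mulDl : left_distributive kalg_mul +%R;
  kalg_mulDr : right_distributive kalg_mul +%R;
  kalg_mulZl : forall c a b, kalg_mul (c *: a) b = c *: kalg_mul a b;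
  kalg_mulZr : forall c a b, kalg_mul a (c *: b) = c *: kalg_mul a b }.

Definition kalg_sort (k : comPzRingType) (A : kalg k) : Type := kalg_mod A.
Coercion kalg_sort : kalg >-> Sortclass.
HB.instance Definition _ k (A : kalg k) :=
  GRing.Lmodule.copy (kalg_sort A) (kalg_mod A).
HB.instance Definition _ k (A : kalg k) :=
  GRing.Zmodule_isPzRing.Build (kalg_sort A) (@kalg_mulA _ A) (@kalg_mul1l _ A)
    (@kalg_mul1r _ A) (@kalg_mulDl _ A) (@kalg_mulDr _ A).

Lemma kscalerAl k (A : kalg k) (c : k) (a b : A) : (c *: a) * b = c *: (a * b).
Proof. exact: kalg_mulZl. Qed.
Lemma kscalerAr k (A : kalg k) (c : k) (a b : A) : a * (c *: b) = c *: (a * b).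
Proof. exact: kalg_mulZr. Qed.

Section Ground.
Variable k : comPzRingType.
Fact ground_mulZl (c : k) (a b : k^o) : (c *: a) * b = c *: (a * b) :> k^o.
Proof. exact: esym (mulrA _ _ _). Qed.
Fact ground_mulZr (c : k) (a b : k^o) : a * (c *: b) = c *: (a * b) :> k^o.
Proof. exact: mulrCA. Qed.
Definition ground : kalg k :=
  @KAlg k k^o 1 *%R (@mulrA k^o) (@mul1r k^o) (@mulr1 k^o) (@mulrDl k^o)
    (@mulrDr k^o) ground_mulZl ground_mulZr.
End Ground.

Section Modules.
Variables (k : comPzRingType) (A : kalg k).

Record rmod := RMod {
  rmod_sort :> lmodType k;
  ract : rmod_sort -> A -> rmod_sort;
  ractDl : forall m n a, ract (m + n) a = ract m a + ract n a;
  ractDr : forall m a b, ract m (a + b) = ract m a + ract m b;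
  ractZl : forall c m a, ract (c *: m) a = c *: ract m a;
  ractZr : forall c m a, ract m (c *: a) = c *: ract m a;
  ract1 : forall m, ract m 1 = m;
  ractA : forall m a b, ract (ract m a) b = ract m (a * b) }.

Record lmod := LMod {
  lmod_sort :> lmodType k;
  lact : A -> lmod_sort -> lmod_sort;
  lactDl : forall a b m, lact (a + b) m = lact a m + lact b m;
  lactDr : forall a m n, lact a (m + n) = lact a m + lact a n;
  lactZl : forall c a m, lact (c *: a) m = c *: lact a m;
  lactZr : forall c a m, lact a (c *: m) = c *: lact a m;
  lact1 : forall m, lact 1 m = m;
  lactA : forall a b m, lact a (lact b m) = lact (a * b) m }.

(* Both structures live on the same k-module [bimod_lmod]. *)
Record bimod := BiMod {
  bimod_lmod :> lmod;
  bact : bimod_lmod -> A -> bimod_lmod;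
  bactDl : forall m n a, bact (m + n) a = bact m a + bact n a;
  bactDr : forall m a b, bact m (a + b) = bact m a + bact m b;
  bactZl : forall c m a, bact (c *: m) a = c *: bact m a;
  bactZr : forall c m a, bact m (c *: a) = c *: bact m a;
  bact1 : forall m, bact m 1 = m;
  bactA : forall m a b, bact (bact m a) b = bact m (a * b);
  lact_bact : forall a m b, bact (lact a m) b = lact a (bact m b) }.

Definition bimod_rmod (M : bimod) : rmod :=
  RMod (@bactDl M) (@bactDr M) (@bactZl M) (@bactZr M) (@bact1 M) (@bactA M).

Definition regular_rmod : rmod :=
  @RMod A *%R (@mulrDl A) (@mulrDr A) (@kscalerAl k A) (@kscalerAr k A) (@mulr1 A)
    (fun a b c => esym (mulrA a b c)).

End Modules.

Coercion bimod_rmod : bimod >-> rmod.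
Canonical bimod_rmod.
Infix "◃" := ract (at level 40, left associativity) : ring_scope.
Infix "▹" := lact (at level 38, right associativity) : ring_scope.

Lemma lact_ract k (A : kalg k) (M : bimod A) (a : A) (m : M) (b : A) :
  (a ▹ m) ◃ b = a ▹ (m ◃ b).
Proof. exact: lact_bact. Qed.

(* M ⊗_A N: formal sums (finite sequences) of pure tensors, modulo the least
   congruence making (m, n) biadditive and A-balanced. *)
Section Tensor.
Variables (k : comPzRingType) (A : kalg k) (M : rmod A) (N : lmod A).

Inductive tens_eq : seq (M * N) -> seq (M * N) -> Prop :=
| TensRefl s : tens_eq s s
| TensSym s t : tens_eq s t -> tens_eq t s
| TensTrans s t u : tens_eq s t -> tens_eq t u -> tens_eq s u
| TensCat s s' t t' :
    tens_eq s s' -> tens_eq t t' -> tens_eq (s ++ t) (s' ++ t')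
| TensComm s t : tens_eq (s ++ t) (t ++ s)
| TensZero n : tens_eq [:: (0, n)] [::]
| TensDl m m' n : tens_eq [:: (m + m', n)] [:: (m, n); (m', n)]
| TensDr m n n' : tens_eq [:: (m, n + n')] [:: (m, n); (m, n')]
| TensBal m a n : tens_eq [:: (m ◃ a, n)] [:: (m, a ▹ n)].

Definition tens_eqb s t := `[< tens_eq s t >].

Fact tens_eqb_refl : reflexive tens_eqb.
Proof. by move=> s; apply/asboolP/TensRefl. Qed.
Fact tens_eqb_sym : symmetric tens_eqb.
Proof. by move=> s t; apply/asboolP/asboolP; exact: TensSym. Qed.
Fact tens_eqb_trans : transitive tens_eqb.
Proof.
by move=> t s u /asboolP st /asboolP tu; apply/asboolP/(TensTrans st tu).
Qed.
Canonical tens_equiv := EquivRel tens_eqb tens_eqb_refl tens_eqb_sym tens_eqb_trans.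

Definition tensor : Type := {eq_quot tens_equiv}.
HB.instance Definition _ := Choice.on tensor.

Definition tens_class (s : seq (M * N)) : tensor := \pi_{eq_quot tens_equiv} s.
Definition tens_repr (t : tensor) : seq (M * N) := repr (t : {eq_quot tens_equiv}).

Lemma tens_reprK t : tens_class (tens_repr t) = t.
Proof. exact: reprK. Qed.
Lemma tens_classP s t : tens_class s = tens_class t <-> tens_eq s t.
Proof. by split=> [/eqmodP/asboolP | st]; last apply/eqmodP/asboolP. Qed.

Definition tens (m : M) (n : N) : tensor := tens_class [:: (m, n)].

Let opps (s : seq (M * N)) := [seq (- p.1, p.2) | p <- s].
Let scales c (s : seq (M * N)) := [seq (c *: p.1, p.2) | p <- s].

Let tens_eq_scales c s t : tens_eq s t -> tens_eq (scales c s) (scales c t).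
Proof.
rewrite /scales; elim=> {s t} /=.
- by move=> s; apply: TensRefl.
- by move=> s t _; apply: TensSym.
- by move=> s t u _ st _; apply: TensTrans.
- by move=> s s' t t' _ ss' _ tt'; rewrite !map_cat; apply: TensCat.
- by move=> s t; rewrite !map_cat; apply: TensComm.
- by move=> n; rewrite scaler0; apply: TensZero.
- by move=> m m' n; rewrite scalerDr; apply: TensDl.
- by move=> m n n'; apply: TensDr.
- by move=> m a n; rewrite -ractZl; apply: TensBal.
Qed.

Let tens_eq_opps s t : tens_eq s t -> tens_eq (opps s) (opps t).
Proof.
move/(tens_eq_scales (-1)); rewrite /scales /opps.
by rewrite !(eq_map (fun p => congr1 (pair^~ p.2) (scaleN1r p.1))).
Qed.

Let tens_eq_addN s : tens_eq (opps s ++ s) [::].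
Proof.
elim: s => [|[m n] s IHs]; first exact: (TensRefl [::]).
have -> : opps ((m, n) :: s) ++ (m, n) :: s
        = [:: (- m, n)] ++ (opps s ++ [:: (m, n)]) ++ s by rewrite -catA.
apply: (TensTrans (t := ([:: (- m, n)] ++ [:: (m, n)]) ++ opps s ++ s)).
  rewrite -(catA [:: (- m, n)] [:: (m, n)]) (catA [:: (m, n)]); apply: TensCat; first exact: TensRefl.
  by apply: TensCat; [exact: TensComm | exact: TensRefl].
apply: (TensTrans (t := [::] ++ [::])); last exact: TensRefl.
apply: TensCat => //=; apply: (TensTrans (TensSym (TensDl (- m) m n))).
by rewrite addNr; apply: TensZero.
Qed.

Let add (x y : tensor) := tens_class (tens_repr x ++ tens_repr y).
Let opp (x : tensor) := tens_class (opps (tens_repr x)).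
Let scale c (x : tensor) := tens_class (scales c (tens_repr x)).

Let reprP s : tens_eq (tens_repr (tens_class s)) s.
Proof. by apply/tens_classP; rewrite tens_reprK. Qed.
Let addE s t : add (tens_class s) (tens_class t) = tens_class (s ++ t).
Proof. by apply/tens_classP/TensCat; apply: reprP. Qed.
Let oppE s : opp (tens_class s) = tens_class (opps s).
Proof. by apply/tens_classP/tens_eq_opps/reprP. Qed.
Let scaleE c s : scale c (tens_class s) = tens_class (scales c s).
Proof. by apply/tens_classP/tens_eq_scales/reprP. Qed.

Fact tens_addA : associative add.
Proof.
move=> x y z; rewrite -[x]tens_reprK -[y]tens_reprK -[z]tens_reprK.
by rewrite !addE catA.
Qed.
Fact tens_addC : commutative add.
Proof.
move=> x y; rewrite -[x]tens_reprK -[y]tens_reprK !addE.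
exact/tens_classP/TensComm.
Qed.
Fact tens_add0 : left_id (tens_class [::]) add.
Proof. by move=> x; rewrite -[x]tens_reprK !addE. Qed.
Fact tens_addN : left_inverse (tens_class [::]) opp add.
Proof.
by move=> x; rewrite -[x]tens_reprK oppE addE; apply/tens_classP/tens_eq_addN.
Qed.
HB.instance Definition _ :=
  GRing.isZmodule.Build tensor tens_addA tens_addC tens_add0 tens_addN.

Lemma tens_class_cat s t : tens_class (s ++ t) = tens_class s + tens_class t.
Proof. by rewrite -addE. Qed.
Lemma tens_classE s : tens_class s = \sum_(p <- s) tens p.1 p.2.
Proof.
elim: s => [|[m n] s IHs]; first by rewrite big_nil.
by rewrite big_cons -IHs -cat1s tens_class_cat.
Qed.

Lemma tensDl m m' n : tens (m + m') n = tens m n + tens m' n.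
Proof. by rewrite -tens_class_cat; apply/tens_classP/TensDl. Qed.
Lemma tensDr m n n' : tens m (n + n') = tens m n + tens m n'.
Proof. by rewrite -tens_class_cat; apply/tens_classP/TensDr. Qed.
Lemma tens_bal m a n : tens (m ◃ a) n = tens m (a ▹ n).
Proof. exact/tens_classP/TensBal. Qed.

Let scale_sum c s : scale c (tens_class s) = \sum_(p <- s) tens (c *: p.1) p.2.
Proof. by rewrite scaleE tens_classE big_map. Qed.

Fact tens_scaleA a b x : scale a (scale b x) = scale (a * b) x.
Proof.
rewrite -[x]tens_reprK !scaleE; congr tens_class; rewrite /scales -map_comp.
by apply: eq_map => p /=; rewrite scalerA.
Qed.
Fact tens_scale1 : left_id 1 scale.
Proof.
move=> x; rewrite -[in LHS](tens_reprK x) scaleE /scales -[RHS]tens_reprK.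
by congr tens_class; rewrite -[RHS]map_id; apply: eq_map => -[m n] /=; rewrite scale1r.
Qed.
Fact tens_scaleDr : right_distributive scale +%R.
Proof.
move=> c x y; rewrite -[x]tens_reprK -[y]tens_reprK -tens_class_cat !scaleE.
by rewrite /scales map_cat tens_class_cat.
Qed.
Fact tens_scaleDl x : {morph scale^~ x : a b / a + b}.
Proof.
move=> a b; rewrite -[x]tens_reprK !scale_sum -big_split.
by apply: eq_bigr => p _; rewrite scalerDl tensDl.
Qed.
HB.instance Definition _ := GRing.Zmodule_isLmodule.Build k tensor
  tens_scaleA tens_scale1 tens_scaleDr tens_scaleDl.

Lemma tensZl c m n : tens (c *: m) n = c *: tens m n.
Proof. by rewrite [RHS]scaleE. Qed.
Lemma tensZr c m n : tens m (c *: n) = c *: tens m n.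
Proof.
by rewrite -[n](lact1 (l := N)) -lactZl -tens_bal ractZr ract1 lact1 tensZl.
Qed.

End Tensor.

Notation "M ⊗[ A ] N" := (@tensor _ A M N)
  (at level 40, A at level 200, left associativity, format "M  ⊗[ A ]  N") : type_scope.
Notation "m ⊗[ A ] n" := (@tens _ A _ _ m n)
  (at level 40, A at level 200, left associativity, format "m  ⊗[ A ]  n") : ring_scope.

Section GroundModules.
Variables (k : comPzRingType) (M : lmodType k).

Let sc (c : ground k) (m : M) : M := (c : k) *: m.
Fact scDl a b m : sc (a + b) m = sc a m + sc b m. Proof. exact: scalerDl. Qed.
Fact scDr a m n : sc a (m + n) = sc a m + sc a n. Proof. exact: scalerDr. Qed.
Fact scZl (c : k) a m : sc (c *: a) m = c *: sc a m.
Proof. by rewrite /sc scalerA. Qed.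
Fact scZr (c : k) a m : sc a (c *: m) = c *: sc a m.
Proof. by rewrite /sc !scalerA mulrC. Qed.
Fact sc1 m : sc 1 m = m. Proof. exact: scale1r. Qed.
Fact scA a b m : sc a (sc b m) = sc (a * b) m. Proof. exact: scalerA. Qed.
Fact scC a b m : sc b (sc a m) = sc (a * b) m.
Proof. rewrite /sc scalerA; congr (_ *: m); exact: (@mulrC k). Qed.

Definition kr : rmod (ground k) := @RMod k (ground k) M (fun m c => sc c m)
  (fun m n c => scDr c m n) (fun m a b => scDl a b m) (fun c m a => scZr c a m)
  (fun c m a => scZl c a m) sc1 (fun m a b => scC a b m).
Definition kl : lmod (ground k) :=
  @LMod k (ground k) M sc scDl scDr scZl scZr sc1 scA.
End GroundModules.

Notation "M ⊗ N" := (tensor (kr M%type) (kl N%type))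
  (at level 40, left associativity) : type_scope.
Notation "m ⊗ n" := (@tens _ (ground _) (kr _) (kl _) m n)
  (at level 40, left associativity) : ring_scope.

(* Sweedler sum over a chosen decomposition t = Σ m ⊗ n; by [tsum_tens] and
   [klin_tsum] it is the map induced by f as soon as f is bilinear and balanced. *)
Definition tsum (k : comPzRingType) (A : kalg k) (M : rmod A) (N : lmod A)
    (P : nmodType) (t : M ⊗[A] N) (f : M -> N -> P) : P :=
  \sum_(p <- tens_repr t) f p.1 p.2.
Notation "\tsum_ ( m , n <- t ) E" := (tsum t (fun m n => E))
  (at level 41, E at level 41, m name, n name, t at level 200,
   format "'[' \tsum_ ( m ,  n  <-  t ) '/  '  E ']'") : ring_scope.

Definition klin (k : comPzRingType) (P Q : lmodType k) (f : P -> Q) : Prop :=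
  forall c x y, f (c *: x + y) = c *: f x + f y.

Section Sweedler.
Variables (k : comPzRingType) (A : kalg k) (M : rmod A) (N : lmod A).

Record balanced (P : lmodType k) (f : M -> N -> P) : Prop := Balanced {
  balanced_l : forall n, klin (f^~ n);
  balanced_r : forall m, klin (f m);
  balanced_a : forall m a n, f (m ◃ a) n = f m (a ▹ n) }.

Lemma klinD (P Q : lmodType k) (f : P -> Q) : klin f -> {morph f : x y / x + y}.
Proof. by move=> fL x y; rewrite -{1}[x]scale1r fL scale1r. Qed.
Lemma klin0 (P Q : lmodType k) (f : P -> Q) : klin f -> f 0 = 0.
Proof. by move=> fL; apply: (addrI (f 0)); rewrite -klinD // !addr0. Qed.
Lemma klinZ (P Q : lmodType k) (f : P -> Q) c : klin f -> {morph f : x / c *: x}.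
Proof. by move=> fL x; rewrite -[c *: x]addr0 fL klin0 // addr0. Qed.
Lemma klin_sum (P Q : lmodType k) (f : P -> Q) I (r : seq I) (F : I -> P) :
  klin f -> f (\sum_(i <- r) F i) = \sum_(i <- r) f (F i).
Proof. by move=> fL; exact: (big_morph f (klinD fL) (klin0 fL)). Qed.

Lemma tens_eq_sum (P : lmodType k) (f : M -> N -> P) s t : balanced f ->
  tens_eq s t -> \sum_(p <- s) f p.1 p.2 = \sum_(p <- t) f p.1 p.2.
Proof.
case=> fl fr fa; elim=> {s t} //=.
- by move=> s t u _ -> _.
- by move=> s s' t t' _ ss _ tt; rewrite !big_cat /= ss tt.
- by move=> s t; rewrite !big_cat /= addrC.
- by move=> n; rewrite big_seq1 big_nil /= (klin0 (fl n)).
- by move=> m m' n; rewrite !big_cons !big_nil !addr0 /= (klinD (fl n)).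
- by move=> m n n'; rewrite !big_cons !big_nil !addr0 /= (klinD (fr m)).
- by move=> m a n; rewrite !big_seq1 /= fa.
Qed.

Lemma tsum_class (P : lmodType k) (f : M -> N -> P) s : balanced f ->
  tsum (tens_class s) f = \sum_(p <- s) f p.1 p.2.
Proof. by move=> fB; apply/(tens_eq_sum fB)/tens_classP; rewrite tens_reprK. Qed.

Lemma tsum_tens (P : lmodType k) (f : M -> N -> P) m n : balanced f ->
  tsum (m ⊗[A] n) f = f m n.
Proof. by move=> fB; rewrite tsum_class // big_seq1. Qed.

Lemma tsum_id (t : M ⊗[A] N) : \tsum_(m, n <- t) m ⊗[A] n = t.
Proof. by rewrite /tsum -tens_classE tens_reprK. Qed.

Lemma tsum_klin (P : lmodType k) (f : M -> N -> P) : balanced f -> klin (fun t => tsum t f).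
Proof.
move=> fB c x y; rewrite -(tens_reprK x) -(tens_reprK y).
have -> s : c *: tens_class s = tens_class [seq (c *: p.1, p.2) | p <- s] :> M ⊗[A] N.
  rewrite !tens_classE big_map scaler_sumr.
  by apply: eq_bigr => p _; rewrite tensZl.
rewrite -tens_class_cat !tsum_class // big_cat big_map scaler_sumr; congr (_ + _).
by apply: eq_bigr => p _ /=; rewrite (klinZ _ (balanced_l fB _)).
Qed.

Lemma klin_tsum (P Q : lmodType k) (g : P -> Q) (f : M -> N -> P) t : klin g ->
  g (tsum t f) = \tsum_(m, n <- t) g (f m n).
Proof. exact: klin_sum. Qed.

Lemma eq_tsum (P : nmodType) (f g : M -> N -> P) t :
  (forall m n, f m n = g m n) -> tsum t f = tsum t g.
Proof. by move=> fg; apply: eq_bigr. Qed.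

Lemma tensor_ext (P : lmodType k) (f g : M ⊗[A] N -> P) : klin f -> klin g ->
  (forall m n, f (m ⊗[A] n) = g (m ⊗[A] n)) -> f =1 g.
Proof.
move=> fL gL fg t; rewrite -[t]tsum_id !klin_tsum //; exact: eq_tsum.
Qed.

End Sweedler.

Section KLin.
Variables (k : comPzRingType) (A : kalg k).
Implicit Types (P Q R : lmodType k) (M : rmod A) (N : lmod A) (C : bimod A).

Lemma klin_id P : klin (fun x : P => x). Proof. by []. Qed.
Lemma klin_linear P Q R (f : {linear Q -> R}) (g : P -> Q) :
  klin g -> klin (fun x => f (g x)).
Proof. by move=> gL c x y; rewrite gL linearP. Qed.
Lemma klin_scalar P Q R (f : {scalar Q}) (g : P -> Q) (r : R) :
  klin g -> klin (fun x => f (g x) *: r).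
Proof. by move=> gL c x y; rewrite gL linearP scalerDl scalerA. Qed.
Lemma klin_scale P Q c (g : P -> Q) : klin g -> klin (fun x => c *: g x).
Proof. by move=> gL d x y; rewrite gL scalerDr !scalerA mulrC. Qed.
Lemma klin_tensl P M N (g : P -> M) (n : N) :
  klin g -> klin (fun x => g x ⊗[A] n).
Proof. by move=> gL c x y; rewrite gL tensDl tensZl. Qed.
Lemma klin_tensr P M N (g : P -> N) (m : M) :
  klin g -> klin (fun x => m ⊗[A] g x).
Proof. by move=> gL c x y; rewrite gL tensDr tensZr. Qed.
Lemma klin_ktensl P Q R (g : P -> Q) (r : R) : klin g -> klin (fun x => g x ⊗ r).
Proof. by move=> gL c x y; rewrite gL tensDl tensZl. Qed.
Lemma klin_ktensr P Q R (g : P -> R) (q : Q) : klin g -> klin (fun x => q ⊗ g x).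
Proof. by move=> gL c x y; rewrite gL tensDr tensZr. Qed.
Lemma klin_ractl P M (g : P -> M) a : klin g -> klin (fun x => g x ◃ a).
Proof. by move=> gL c x y; rewrite gL ractDl ractZl. Qed.
Lemma klin_ractr P M (g : P -> A) (m : M) : klin g -> klin (fun x => m ◃ g x).
Proof. by move=> gL c x y; rewrite gL ractDr ractZr. Qed.
Lemma klin_lactl P N (g : P -> A) (n : N) : klin g -> klin (fun x => g x ▹ n).
Proof. by move=> gL c x y; rewrite gL lactDl lactZl. Qed.
Lemma klin_lactr P N (g : P -> N) a : klin g -> klin (fun x => a ▹ g x).
Proof. by move=> gL c x y; rewrite gL lactDr lactZr. Qed.
Lemma klin_mull P (g : P -> A) a : klin g -> klin (fun x => g x * a).
Proof. by move=> gL c x y; rewrite gL mulrDl kscalerAl. Qed.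
Lemma klin_mulr P (g : P -> A) a : klin g -> klin (fun x => a * g x).
Proof. by move=> gL c x y; rewrite gL mulrDr kscalerAr. Qed.
Lemma klin_tsuml P Q M N (f : M -> N -> Q) (g : P -> M ⊗[A] N) :
  balanced f -> klin g -> klin (fun x => tsum (g x) f).
Proof. by move=> fB gL c x y; rewrite gL tsum_klin. Qed.
Lemma klin_tsumr P Q M N (f : P -> M -> N -> Q) t :
  (forall m n, klin (fun x => f x m n)) -> klin (fun x => tsum t (f x)).
Proof.
move=> fL c x y; rewrite /tsum scaler_sumr -big_split.
by apply: eq_bigr => p _ /=; rewrite fL.
Qed.
Lemma balancedk P Q R (f : P -> Q -> R) :
  (forall q, klin (f^~ q)) -> (forall p, klin (f p)) ->
  balanced (M := kr P) (N := kl Q) f.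
Proof. by move=> fl fr; split=> //= p c q; rewrite (klinZ _ (fl q)) (klinZ _ (fr p)). Qed.

End KLin.

Ltac klin := intros; cbv beta; solve
  [ assumption | exact: klin_id
  | apply: klin_ktensl; klin | apply: klin_ktensr; klin
  | apply: klin_tensl; klin | apply: klin_tensr; klin
  | apply: klin_ractl; klin | apply: klin_ractr; klin
  | apply: klin_lactl; klin | apply: klin_lactr; klin
  | apply: klin_mull; klin | apply: klin_mulr; klin
  | apply: klin_scalar; klin | apply: klin_scale; klin
  | apply: klin_linear; klin
  | apply: tsum_klin; balanced
  | apply: klin_tsuml; [balanced | klin] | apply: klin_tsumr; klin ]
with balanced := solve
  [ assumption | apply: balancedk; klin
  | split; [klin | klin | by move=> *; rewrite /= ?lact_ract ?tens_bal ?ractA ?lactA ?mulrA] ].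

Section TensorModules.
Variables (k : comPzRingType) (A : kalg k).

Section Right.
Variables (M : rmod A) (N : bimod A).
Definition tensor_ract (t : M ⊗[A] N) (a : A) : M ⊗[A] N :=
  \tsum_(m, n <- t) m ⊗[A] (n ◃ a).
Fact tensor_ract_balanced a : balanced (fun (m : M) (n : N) => m ⊗[A] (n ◃ a)).
Proof. by split; [klin | klin | move=> *; rewrite tens_bal -lact_ract]. Qed.
Fact tensor_ractE m n a : tensor_ract (m ⊗[A] n) a = m ⊗[A] (n ◃ a).
Proof. exact: tsum_tens (tensor_ract_balanced a). Qed.
Fact tensor_ract_klin a : klin (tensor_ract^~ a).
Proof. exact: tsum_klin (tensor_ract_balanced a). Qed.
Fact tensor_ract_klinr t : klin (tensor_ract t).
Proof. rewrite /tensor_ract; klin. Qed.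
Fact tensor_ract1 t : tensor_ract t 1 = t.
Proof. by rewrite -[RHS]tsum_id; apply: eq_tsum => m n; rewrite ract1. Qed.
Fact tensor_ractA t a b : tensor_ract (tensor_ract t a) b = tensor_ract t (a * b).
Proof.
rewrite (klin_tsum _ _ (tensor_ract_klin b)); apply: eq_tsum => m n.
by rewrite tensor_ractE ractA.
Qed.
Definition tensor_rmod : rmod A := @RMod k A (M ⊗[A] N)%type tensor_ract
  (fun m n a => klinD (tensor_ract_klin a) m n) (fun t a b => klinD (tensor_ract_klinr t) a b)
  (fun c m a => klinZ c (tensor_ract_klin a) m) (fun c t a => klinZ c (tensor_ract_klinr t) a)
  tensor_ract1 tensor_ractA.
End Right.

Section Left.
Variables (M : bimod A) (N : lmod A).
Definition tensor_lact (a : A) (t : M ⊗[A] N) : M ⊗[A] N :=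
  \tsum_(m, n <- t) (a ▹ m) ⊗[A] n.
Fact tensor_lact_balanced a : balanced (fun (m : M) (n : N) => (a ▹ m) ⊗[A] n).
Proof. by split; [klin | klin | move=> *; rewrite -tens_bal; rewrite lact_ract]. Qed.
Fact tensor_lactE a m n : tensor_lact a (m ⊗[A] n) = (a ▹ m) ⊗[A] n.
Proof. exact: tsum_tens (tensor_lact_balanced a). Qed.
Fact tensor_lact_klin a : klin (tensor_lact a).
Proof. exact: tsum_klin (tensor_lact_balanced a). Qed.
Fact tensor_lact_klinl t : klin (tensor_lact^~ t).
Proof. rewrite /tensor_lact; klin. Qed.
Fact tensor_lact1 t : tensor_lact 1 t = t.
Proof. by rewrite -[RHS]tsum_id; apply: eq_tsum => m n; rewrite lact1. Qed.
Fact tensor_lactA a b t : tensor_lact a (tensor_lact b t) = tensor_lact (a * b) t.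
Proof.
rewrite (klin_tsum _ _ (tensor_lact_klin a)); apply: eq_tsum => m n.
by rewrite tensor_lactE lactA.
Qed.
Definition tensor_lmod : lmod A := @LMod k A (M ⊗[A] N)%type tensor_lact
  (fun a b t => klinD (tensor_lact_klinl t) a b) (fun a m n => klinD (tensor_lact_klin a) m n)
  (fun c a t => klinZ c (tensor_lact_klinl t) a) (fun c a m => klinZ c (tensor_lact_klin a) m)
  tensor_lact1 tensor_lactA.
End Left.

Fact tensor_lact_ract (M N : bimod A) a (t : M ⊗[A] N) b :
  tensor_ract (tensor_lact a t) b = tensor_lact a (tensor_ract t b).
Proof.
rewrite (klin_tsum _ _ (tensor_ract_klin b)) (klin_tsum _ _ (tensor_lact_klin a)).
by apply: eq_tsum => m n; rewrite tensor_ractE tensor_lactE.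
Qed.
Definition tensor_bimod (M N : bimod A) : bimod A :=
  @BiMod k A (tensor_lmod M N) (@tensor_ract M N)
  (@ractDl k A (tensor_rmod M N)) (@ractDr k A (tensor_rmod M N))
  (@ractZl k A (tensor_rmod M N)) (@ractZr k A (tensor_rmod M N))
  (@ract1 k A (tensor_rmod M N)) (@ractA k A (tensor_rmod M N))
  (@tensor_lact_ract M N).

End TensorModules.

(* m ⊗ t with t itself in a tensor product; the left module structure of the
   latter cannot be inferred from its carrier. *)
Notation "m ⊗[ A ]: t" := (@tens _ A _ (tensor_lmod _ _) m t)
  (at level 40, A at level 200, left associativity, format "m  ⊗[ A ]:  t") : ring_scope.

Section Structures.
Variable k : comPzRingType.

Record coalgebra := Coalgebra {
  coalg_sort :> lmodType k;
  comul : {linear coalg_sort -> (coalg_sort ⊗ coalg_sort)%type};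
  counit : {scalar coalg_sort};
  comulA : forall d : coalg_sort,
    \tsum_(d1, d2 <- comul d) \tsum_(d11, d12 <- comul d1) d11 ⊗ (d12 ⊗ d2)
    = \tsum_(d1, d2 <- comul d) d1 ⊗ comul d2;
  counitl : forall d : coalg_sort, \tsum_(d1, d2 <- comul d) counit d1 *: d2 = d;
  counitr : forall d : coalg_sort, \tsum_(d1, d2 <- comul d) counit d2 *: d1 = d }.

Record is_kcomodule (D : coalgebra) (M : lmodType k)
    (rho : {linear M -> (M ⊗ D)%type}) : Prop := IsKcomodule {
  kcomoduleA : forall m,
    \tsum_(m0, d <- rho m) \tsum_(m00, m01 <- rho m0) m00 ⊗ (m01 ⊗ d)
    = \tsum_(m0, d <- rho m) m0 ⊗ comul D d;
  kcomodule_counit : forall m, \tsum_(m0, d <- rho m) counit D d *: m0 = m }.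

(* Right D-colinearity of p : D -> M for the regular coaction on D. *)
Definition colinear (D : coalgebra) (M : lmodType k) (rho : M -> (M ⊗ D)%type)
    (p : D -> M) : Prop :=
  forall d, rho (p d) = \tsum_(d1, d2 <- comul D d) p d1 ⊗ d2.

Variable A : kalg k.

Record coring := Coring {
  cor_bimod :> bimod A;
  ccomul : {linear cor_bimod -> (cor_bimod ⊗[A] cor_bimod)%type};
  ccounit : {linear cor_bimod -> A};
  ccomul_lact : forall a c, ccomul (a ▹ c) = tensor_lact a (ccomul c);
  ccomul_ract : forall c a, ccomul (c ◃ a) = tensor_ract (ccomul c) a;
  ccounit_lact : forall a c, ccounit (a ▹ c) = a * ccounit c;
  ccounit_ract : forall c a, ccounit (c ◃ a) = ccounit c * a;
  ccomulA : forall c,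
    \tsum_(c1, c2 <- ccomul c) \tsum_(c11, c12 <- ccomul c1)
      c11 ⊗[A]: (c12 ⊗[A] c2)
    = \tsum_(c1, c2 <- ccomul c)
      c1 ⊗[A]: (ccomul c2);
  ccounitl : forall c, \tsum_(c1, c2 <- ccomul c) ccounit c1 ▹ c2 = c;
  ccounitr : forall c, \tsum_(c1, c2 <- ccomul c) c1 ◃ ccounit c2 = c }.

Record is_rcomodule (C : coring) (M : rmod A)
    (rho : {linear M -> (M ⊗[A] C)%type}) : Prop := IsRcomodule {
  rcomodule_ract : forall m a, rho (m ◃ a) = tensor_ract (rho m) a;
  rcomoduleA : forall m,
    \tsum_(m0, c <- rho m) \tsum_(m00, m01 <- rho m0)
      m00 ⊗[A]: (m01 ⊗[A] c)
    = \tsum_(m0, c <- rho m) m0 ⊗[A]: (ccomul C c);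
  rcomodule_counit : forall m, \tsum_(m0, c <- rho m) m0 ◃ ccounit C c = m }.

(* M -> M ⊗_A C is the equalizer of rho ⊗ C and M ⊗ Δ; purity asks that
   - ⊗ (D ⊗ D) preserves it. *)
Definition preserves_equalizer (C : coring) (M : rmod A)
    (rho : {linear M -> (M ⊗[A] C)%type}) (W : lmodType k) : Prop :=
  forall y : (M ⊗[A] C) ⊗ W,
    \tsum_(z, w <- y)
      (\tsum_(m, c <- z) \tsum_(m0, m1 <- rho m)
        m0 ⊗[A]: (m1 ⊗[A] c)) ⊗ w
    = \tsum_(z, w <- y)
      (\tsum_(m, c <- z) m ⊗[A]: (ccomul C c)) ⊗ w ->
  exists! x : M ⊗ W, \tsum_(m, w <- x) rho m ⊗ w = y.

(* C is a left C-, right D-bicomodule for its regular left C-coaction. *)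
Record pure_extension (C : coring) (D : coalgebra) := PureExtension {
  ext_coact : {linear C -> (C ⊗ D)%type};
  ext_comodule : is_kcomodule ext_coact;
  ext_lact : forall a c,
    ext_coact (a ▹ c) = \tsum_(c0, d <- ext_coact c) (a ▹ c0) ⊗ d;
  ext_colinear : forall c,
    \tsum_(c0, d <- ext_coact c) ccomul C c0 ⊗ d
    = \tsum_(c1, c2 <- ccomul C c) \tsum_(c20, d <- ext_coact c2)
        (c1 ⊗[A] c20) ⊗ d;
  ext_pure : forall (M : rmod A) (rho : {linear M -> (M ⊗[A] C)%type}),
    is_rcomodule rho -> preserves_equalizer rho (D ⊗ D)%type }.

End Structures.

Section Purity.
Variables (k : comPzRingType) (A : kalg k) (C : coring A) (M : rmod A).
Variable rho : {linear M -> (M ⊗[A] C)%type}.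
Hypothesis rhoP : is_rcomodule rho.

Let counit_bal (W : lmodType k) (w : W) :
  balanced (fun (m : M) (c : C) => (m ◃ ccounit C c) ⊗ w).
Proof. by split; [klin | klin | move=> m a c /=; rewrite ractA ccounit_lact]. Qed.

Lemma rcomodule_preserves_equalizer (W : lmodType k) : preserves_equalizer rho W.
Proof.
move=> y yP.
pose eps (z : M ⊗[A] C) := \tsum_(m, c <- z) m ◃ ccounit C c.
have epsB : balanced (fun (m : M) (c : C) => m ◃ ccounit C c).
  by split; [klin | klin | move=> m a c /=; rewrite ractA ccounit_lact].
have epsL : klin eps by apply: tsum_klin.
have rhoT : forall x : M ⊗ W,
    \tsum_(z, w <- \tsum_(m, w <- x) rho m ⊗ w) eps z ⊗ w = x.
  move=> x; rewrite -[RHS]tsum_id.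
  have L : balanced (M := kr (M ⊗[A] C)%type) (N := kl W) (fun z w => eps z ⊗ w).
    by apply: balancedk; [move=> w; apply: klin_tensl | klin].
  rewrite (klin_tsum _ _ (tsum_klin L)); apply: eq_tsum => m w.
  by rewrite tsum_tens // /eps (rcomodule_counit rhoP).
exists (\tsum_(z, w <- y) eps z ⊗ w); split; last by move=> x' <-.
have rB : balanced (M := kr M) (N := kl W) (fun m w => rho m ⊗ w) by balanced.
rewrite (klin_tsum _ _ (tsum_klin rB)).
pose H (t : M ⊗[A] (tensor_lmod C C)) :=
  \tsum_(m, t' <- t) m ⊗[A] \tsum_(c, c' <- t') c ◃ ccounit C c'.
have hB : balanced (fun c c' : C => c ◃ ccounit C c').
  by split; [klin | klin | move=> m a c /=; rewrite ractA ccounit_lact].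
have HB : balanced (fun (m : M) (t' : tensor_lmod C C) =>
    m ⊗[A] \tsum_(c, c' <- t') c ◃ ccounit C c').
  split; [klin | by move=> m; apply: klin_tensr; apply: tsum_klin |].
  move=> m a t /=; rewrite tens_bal; congr tens.
  rewrite (klin_tsum _ _ (@klin_lactr k A _ C _ a (@klin_id _ _))).
  rewrite (klin_tsum _ _ (tsum_klin hB)); apply: eq_tsum => c c'.
  by rewrite tsum_tens // lact_ract.
have HL : klin H by apply: tsum_klin.
have HtB : balanced (M := kr (M ⊗[A] (tensor_lmod C C))%type) (N := kl W)
    (fun t w => H t ⊗ w).
  by apply: balancedk; [move=> w; apply: klin_tensl | klin].
move/(congr1 (fun x : (M ⊗[A] (tensor_lmod C C)) ⊗ W => \tsum_(t, w <- x) H t ⊗ w)): yP.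
rewrite !(klin_tsum _ _ (tsum_klin HtB)) => yP.
rewrite -[RHS]tsum_id; apply: etrans (etrans yP _); last first.
  apply: eq_tsum => z w; rewrite tsum_tens // (klin_tsum _ _ HL).
  congr (_ ⊗ w); rewrite -[RHS]tsum_id; apply: eq_tsum => m c.
  by rewrite /H tsum_tens // ccounitr.
apply: eq_tsum => z w; rewrite !tsum_tens //; congr (_ ⊗ w).
rewrite (klin_tsum _ _ HL) (klin_tsum _ _ (_ : klin rho)); last klin.
apply: eq_tsum => m c; rewrite (klin_tsum _ _ HL) (rcomodule_ract rhoP).
by apply: eq_tsum => m0 m1; rewrite /H !tsum_tens.
Qed.

End Purity.

Section CleftBicomodule.
Variables (k : comPzRingType) (A : kalg k) (C : coring A) (D : coalgebra k).
Variable ext : pure_extension C D.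

(* M^* = Hom_A(M, A), with pointwise left action (a f)(x) = a (f x). *)
Record dual (M : rmod A) := Dual {
  dual_fun :> M -> A;
  dualD : {morph dual_fun : x y / x + y};
  dual_ract : forall x a, dual_fun (x ◃ a) = dual_fun x * a }.

Variables (M : rmod A) (rho : {linear M -> (M ⊗[A] C)%type}).

Definition induced_coaction (m : M) : M ⊗ D :=
  \tsum_(m0, m1 <- rho m) \tsum_(c, d <- ext_coact ext m1) (m0 ◃ ccounit C c) ⊗ d.

Record in_Qtilde (q : C -> dual M) : Prop := InQtilde {
  QtildeD : forall c c' x, q (c + c') x = q c x + q c' x;
  Qtilde_lact : forall a c x, q (a ▹ c) x = a * q c x;
  Qtilde_coact : forall c x,
    \tsum_(c1, c2 <- ccomul C c) c1 ◃ q c2 x = \tsum_(x0, x1 <- rho x) q c x0 ▹ x1 }.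

Definition bullet (q : C -> dual M) (p : D -> M) (c : C) : C :=
  \tsum_(c0, d <- ext_coact ext c) \tsum_(x0, x1 <- rho (p d)) q c0 x0 ▹ x1.

Definition weak_cleft_via : Prop :=
  is_rcomodule rho /\
  exists (j : {linear D -> M}) (q : C -> dual M),
    [/\ colinear induced_coaction j, in_Qtilde q & forall c, bullet q j c = c].

(* The Sweedler sums above are well defined: each summand is bilinear and
   balanced. *)
Lemma dual_klin (f : dual M) : klin f.
Proof.
move=> c x y; rewrite dualD; congr (_ + _).
by rewrite -[x]ract1 -ractZr !dual_ract mulr1 kscalerAr mulr1.
Qed.

Lemma Qtilde_klin q x : in_Qtilde q -> klin (fun c => q c x).
Proof.
move=> qP t c c'; rewrite (QtildeD qP); congr (_ + _).
by rewrite -[c]lact1 -lactZl !(Qtilde_lact qP) mul1r kscalerAl mul1r.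
Qed.

Lemma induced_balanced : balanced (fun (m0 : M) (m1 : C) =>
  \tsum_(c, d <- ext_coact ext m1) (m0 ◃ ccounit C c) ⊗ d).
Proof.
have B (m : M) : balanced (M := kr C) (N := kl D) (fun c d => (m ◃ ccounit C c) ⊗ d).
  by balanced.
split; [klin | by move=> m; apply: klin_tsuml; [exact: B | klin] |].
move=> m a c /=; rewrite ext_lact (klin_tsum _ _ (tsum_klin (B m))).
by apply: eq_tsum => c0 d; rewrite tsum_tens // ccounit_lact ractA.
Qed.

Lemma induced_klin : klin induced_coaction.
Proof. by apply: klin_tsuml; [exact: induced_balanced | klin]. Qed.

Lemma Qtilde_balancedl q x : in_Qtilde q ->
  balanced (fun c1 c2 : C => c1 ◃ q c2 x).
Proof.
move=> qP; split; first klin.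
  by move=> c; apply: klin_ractr; apply: Qtilde_klin.
by move=> c a c' /=; rewrite (Qtilde_lact qP) ractA.
Qed.

Lemma Qtilde_balancedr (f : dual M) : balanced (fun (x0 : M) (x1 : C) => f x0 ▹ x1).
Proof.
split; [by move=> c; apply: klin_lactl; exact: dual_klin | klin |].
by move=> x a c /=; rewrite dual_ract lactA.
Qed.

Lemma bullet_balanced q (p : {linear D -> M}) : in_Qtilde q ->
  balanced (M := kr C) (N := kl D)
    (fun c0 d => \tsum_(x0, x1 <- rho (p d)) q c0 x0 ▹ x1).
Proof.
move=> qP; apply: balancedk => [d|c].
  by apply: klin_tsumr => x0 x1; apply: klin_lactl; apply: Qtilde_klin.
by apply: klin_tsuml; [exact: Qtilde_balancedr | klin].
Qed.

End CleftBicomodule.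

Definition weak_cleft_bicomodule (k : comPzRingType) (A : kalg k) (C : coring A)
    (D : coalgebra k) (ext : pure_extension C D) (M : rmod A) : Prop :=
  exists rho : {linear M -> (M ⊗[A] C)%type}, weak_cleft_via ext rho.

Section WeakEntwining.
Variables (k : comPzRingType) (A : kalg k) (D : coalgebra k).

(* e = (A ⊗ eps) o psi o (D ⊗ 1_A) *)
Definition entw_unit (psi : D ⊗ A -> (A ⊗ D)%type) (d : D) : A :=
  \tsum_(a, d' <- psi (d ⊗ (1 : A))) counit D d' *: a.

Record weak_entwining := WeakEntwining {
  entw :> {linear (D ⊗ A)%type -> (A ⊗ D)%type};
  entw_mul : forall (d : D) (a b : A),
    entw (d ⊗ (a * b))
    = \tsum_(a', d' <- entw (d ⊗ a)) \tsum_(b', d'' <- entw (d' ⊗ b)) (a' * b') ⊗ d'';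
  entw_comul : forall (d : D) (a : A),
    \tsum_(a', d' <- entw (d ⊗ a)) a' ⊗ comul D d'
    = \tsum_(d1, d2 <- comul D d) \tsum_(a', d2' <- entw (d2 ⊗ a))
        \tsum_(a'', d1' <- entw (d1 ⊗ a')) a'' ⊗ (d1' ⊗ d2');
  entw_one : forall d : D,
    entw (d ⊗ (1 : A)) = \tsum_(d1, d2 <- comul D d) entw_unit entw d1 ⊗ d2;
  entw_counit : forall (d : D) (a : A),
    \tsum_(a', d' <- entw (d ⊗ a)) counit D d' *: a' = entw_unit entw d * a }.

Definition is_entwined_module (psi : weak_entwining) (M : rmod A)
    (rho : {linear M -> (M ⊗ D)%type}) : Prop :=
  is_kcomodule rho /\
  forall (m : M) (a : A),
    rho (m ◃ a) = \tsum_(m0, d <- rho m) \tsum_(a', d' <- psi (d ⊗ a)) ((m0 : M) ◃ a') ⊗ d'.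

Definition cleft_via (psi : weak_entwining)
    (rho : {linear regular_rmod A -> (regular_rmod A ⊗ D)%type}) : Prop :=
  is_entwined_module psi rho /\
  exists lam lamb : {linear D -> A},
    [/\ colinear rho lam,
        forall d, \tsum_(a, d' <- rho (1 : A)) (lamb d * a) ⊗ d'
          = \tsum_(d1, d2 <- comul D d) psi (d1 ⊗ lamb d2),
        forall d, \tsum_(a, d' <- psi (d ⊗ (1 : A))) a * lamb d' = lamb d
      & forall d, \tsum_(d1, d2 <- comul D d) lamb d1 * lam d2 = entw_unit psi d].

Definition cleft (psi : weak_entwining) : Prop := exists rho, cleft_via psi rho.
End WeakEntwining.

Section AssociatedCoring.
Variables (k : comPzRingType) (A : kalg k) (D : coalgebra k).
Variable psi : weak_entwining A D.

Definition entw_lact (a : A) (x : A ⊗ D) : A ⊗ D := \tsum_(b, d <- x) (a * b) ⊗ d.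

Definition entw_ract (x : A ⊗ D) (a : A) : A ⊗ D :=
  \tsum_(b, d <- x) \tsum_(a', d' <- psi (d ⊗ a)) (b * a') ⊗ d'.

(* a ⊗ d |-> a 1_psi ⊗ d^psi; the coring is its range. *)
Definition entw_proj (x : A ⊗ D) : A ⊗ D :=
  \tsum_(a, d <- x) \tsum_(a', d' <- psi (d ⊗ (1 : A))) (a * a') ⊗ d'.

Definition entw_range : {pred A ⊗ D} := fun x => `[< exists y, x = entw_proj y >].

Let lactB a : balanced (M := kr A) (N := kl D) (fun b d => (a * b) ⊗ d).
Proof. balanced. Qed.
Let ractB a : balanced (M := kr A) (N := kl D)
  (fun b d => \tsum_(a', d' <- psi (d ⊗ a)) (b * a') ⊗ d').
Proof. balanced. Qed.
Let lact_klin a : klin (entw_lact a). Proof. exact: tsum_klin. Qed.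
Let lact_klinl x : klin (entw_lact^~ x). Proof. rewrite /entw_lact; klin. Qed.
Let ract_klin a : klin (entw_ract^~ a). Proof. exact: tsum_klin. Qed.
Let ract_klinr x : klin (entw_ract x).
Proof. by rewrite /entw_ract; klin. Qed.
Let lactE a b d : entw_lact a (b ⊗ d) = (a * b) ⊗ d.
Proof. exact: tsum_tens. Qed.
Let ractE b d a : entw_ract (b ⊗ d) a = entw_lact b (psi (d ⊗ a)).
Proof. exact: tsum_tens. Qed.

Let lact_mul a b x : entw_lact a (entw_lact b x) = entw_lact (a * b) x.
Proof.
rewrite (klin_tsum _ _ (lact_klin a)); apply: eq_tsum => c d.
by rewrite lactE mulrA.
Qed.
Let lact_one x : entw_lact 1 x = x.
Proof. by rewrite -[RHS]tsum_id; apply: eq_tsum => b d; rewrite mul1r. Qed.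

Let lact_ractC a x b : entw_ract (entw_lact a x) b = entw_lact a (entw_ract x b).
Proof.
rewrite (klin_tsum _ _ (ract_klin b)) (klin_tsum _ _ (lact_klin a)).
by apply: eq_tsum => c d; rewrite ractE -lact_mul.
Qed.

Let ract_mul x a b : entw_ract (entw_ract x a) b = entw_ract x (a * b).
Proof.
rewrite (klin_tsum _ _ (ract_klin b)); apply: eq_tsum => c d.
rewrite -/(entw_lact c _) lact_ractC -/(entw_lact c _) entw_mul.
by congr entw_lact.
Qed.

Let projE x : entw_proj x = entw_ract x 1. Proof. by []. Qed.
Let proj_id x : entw_proj (entw_proj x) = entw_proj x.
Proof. by rewrite !projE ract_mul mulr1. Qed.

Lemma entw_rangeP x : reflect (entw_proj x = x) (x \in entw_range).
Proof.
apply: (iffP idP) => [/asboolP[y ->]|<-]; first exact: proj_id.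
by apply/asboolP; exists x.
Qed.

Fact entw_range_submod : subsemimod_closed entw_range.
Proof.
apply: GRing.submod_closed_semi; split=> [|c x y].
  by apply/entw_rangeP; rewrite projE (klin0 (ract_klin 1)).
move=> /entw_rangeP xP /entw_rangeP yP; apply/entw_rangeP.
by rewrite projE (ract_klin 1) -!projE xP yP.
Qed.

Definition entw_coring_sort : Type := {x : A ⊗ D | x \in entw_range}.
HB.instance Definition _ := SubChoice.on entw_coring_sort.
HB.instance Definition _ := GRing.SubChoice_isSubLmodule.Build
  k (A ⊗ D)%type entw_range entw_coring_sort entw_range_submod.

Fact entw_proj_range x : entw_proj x \in entw_range.
Proof. by apply/entw_rangeP; apply: proj_id. Qed.

Let klin_val (P : lmodType k) (g : P -> entw_coring_sort) :
  klin g -> klin (fun x => val (g x)).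
Proof. by move=> gL c x y; rewrite gL linearP. Qed.

Fact entw_lact_range a (c : entw_coring_sort) : entw_lact a (val c) \in entw_range.
Proof.
by apply/entw_rangeP; rewrite projE lact_ractC -projE; congr entw_lact; apply/entw_rangeP/valP.
Qed.
Fact entw_ract_range (c : entw_coring_sort) a : entw_ract (val c) a \in entw_range.
Proof. by apply/entw_rangeP; rewrite projE ract_mul mulr1. Qed.

Let clact (a : A) (c : entw_coring_sort) : entw_coring_sort :=
  Sub (entw_lact a (val c)) (entw_lact_range a c).
Let cract (c : entw_coring_sort) (a : A) : entw_coring_sort :=
  Sub (entw_ract (val c) a) (entw_ract_range c a).
Let val_clact a c : val (clact a c) = entw_lact a (val c). Proof. by []. Qed.
Let val_cract c a : val (cract c a) = entw_ract (val c) a. Proof. by []. Qed.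

Fact clact_klin a : klin (clact a).
Proof. by move=> t c c'; apply: val_inj; rewrite linearP !val_clact linearP lact_klin. Qed.
Fact clact_klinl c : klin (clact^~ c).
Proof. by move=> t a b; apply: val_inj; rewrite linearP !val_clact lact_klinl. Qed.
Fact cract_klin a : klin (cract^~ a).
Proof. by move=> t c c'; apply: val_inj; rewrite linearP !val_cract linearP ract_klin. Qed.
Fact cract_klinr c : klin (cract c).
Proof. by move=> t a b; apply: val_inj; rewrite linearP !val_cract ract_klinr. Qed.
Fact clact1 c : clact 1 c = c.
Proof. by apply: val_inj; rewrite val_clact lact_one. Qed.
Fact clactA a b c : clact a (clact b c) = clact (a * b) c.
Proof. by apply: val_inj; rewrite !val_clact lact_mul. Qed.
Fact cract1 c : cract c 1 = c.
Proof. by apply: val_inj; rewrite val_cract -projE; apply/entw_rangeP/valP. Qed.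
Fact cractA c a b : cract (cract c a) b = cract c (a * b).
Proof. by apply: val_inj; rewrite !val_cract ract_mul. Qed.
Fact clact_cract a c b : cract (clact a c) b = clact a (cract c b).
Proof. by apply: val_inj; rewrite val_cract !val_clact val_cract lact_ractC. Qed.

Definition entw_bimod : bimod A := @BiMod k A
  (@LMod k A entw_coring_sort clact
    (fun a b c => klinD (clact_klinl c) a b) (fun a c c' => klinD (clact_klin a) c c')
    (fun t a c => klinZ t (clact_klinl c) a) (fun t a c => klinZ t (clact_klin a) c)
    clact1 clactA) cract
  (fun c c' a => klinD (cract_klin a) c c') (fun c a b => klinD (cract_klinr c) a b)
  (fun t c a => klinZ t (cract_klin a) c) (fun t c a => klinZ t (cract_klinr c) a)
  cract1 cractA clact_cract.

Local Notation C := entw_bimod.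
Definition to_coring (x : A ⊗ D) : C :=
  Sub (entw_proj x) (entw_proj_range x) : entw_coring_sort.

Lemma val_to_coring x : val (to_coring x : entw_coring_sort) = entw_proj x.
Proof. by []. Qed.
Lemma to_coringK (c : entw_coring_sort) : to_coring (val c) = c.
Proof. by apply: val_inj; rewrite val_to_coring; apply/entw_rangeP/valP. Qed.

Fact to_coring_linear : linear to_coring.
Proof.
by move=> c x y; apply: (val_inj (sT := entw_coring_sort)); rewrite linearP !val_to_coring !projE (ract_klin 1).
Qed.
HB.instance Definition _ := GRing.isLinear.Build k (A ⊗ D)%type C _
  to_coring to_coring_linear.
Local Notation pi := to_coring.

Let val_lact (a : A) (c : C) :
  val (a ▹ c : entw_coring_sort) = entw_lact a (val (c : entw_coring_sort)). Proof. by []. Qed.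
Let val_ract (c : C) (a : A) :
  val (c ◃ a : entw_coring_sort) = entw_ract (val (c : entw_coring_sort)) a. Proof. by []. Qed.
Let pi_lact a x : pi (entw_lact a x) = a ▹ pi x.
Proof. by apply: (val_inj (sT := entw_coring_sort)); rewrite val_lact !val_to_coring !projE lact_ractC. Qed.
Let pi_ract x a : pi (entw_ract x a) = pi x ◃ a.
Proof. by apply: (val_inj (sT := entw_coring_sort)); rewrite val_ract !val_to_coring !projE !ract_mul mul1r mulr1. Qed.
Let pi_proj x : pi (entw_proj x) = pi x.
Proof. by apply: (val_inj (sT := entw_coring_sort)); rewrite !val_to_coring proj_id. Qed.
Let psi1 d a : psi (d ⊗ a) = entw_ract ((1 : A) ⊗ d) a.
Proof. by rewrite ractE lact_one. Qed.

Let comul3 (P : lmodType k) (F : D -> D -> D -> P) d :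
  (forall d2 d3, klin (fun d1 => F d1 d2 d3)) ->
  (forall d1 d3, klin (fun d2 => F d1 d2 d3)) ->
  (forall d1 d2, klin (fun d3 => F d1 d2 d3)) ->
  \tsum_(d1, d2 <- comul D d) \tsum_(d11, d12 <- comul D d1) F d11 d12 d2
  = \tsum_(d1, d2 <- comul D d) \tsum_(d21, d22 <- comul D d2) F d1 d21 d22.
Proof.
move=> F1 F2 F3.
have B1 d1 : balanced (M := kr D) (N := kl D) (F d1) by apply: balancedk.
have B2 : balanced (M := kr D) (N := kl (D ⊗ D)%type) (fun d1 w => tsum w (F d1)).
  apply: balancedk => [w|d1]; last exact: tsum_klin.
  by apply: klin_tsumr => d2 d3; apply: F1.
have := congr1 (fun t : D ⊗ (D ⊗ D) => \tsum_(d1, w <- t) tsum w (F d1)) (comulA d).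
rewrite !(klin_tsum _ _ (tsum_klin B2)) => E.
apply: etrans (etrans E _).
  apply: eq_tsum => d1 d2; rewrite (klin_tsum _ _ (tsum_klin B2)).
  by apply: eq_tsum => d11 d12; rewrite !tsum_tens.
by apply: eq_tsum => d1 d2; rewrite tsum_tens.
Qed.

Definition entw_comulAD (x : A ⊗ D) : C ⊗[A] C :=
  \tsum_(a, d <- x) \tsum_(d1, d2 <- comul D d) pi (a ⊗ d1) ⊗[A] pi ((1 : A) ⊗ d2).

Let comulB : balanced (M := kr A) (N := kl D) (fun a d =>
  \tsum_(d1, d2 <- comul D d) pi (a ⊗ d1) ⊗[A] pi ((1 : A) ⊗ d2)).
Proof. balanced. Qed.
Let comulL : klin entw_comulAD. Proof. exact: tsum_klin. Qed.
Let comulE a d : entw_comulAD (a ⊗ d) =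
  \tsum_(d1, d2 <- comul D d) pi (a ⊗ d1) ⊗[A] pi ((1 : A) ⊗ d2).
Proof. exact: tsum_tens. Qed.

Let comul_lact a x : entw_comulAD (entw_lact a x) = tensor_lact a (entw_comulAD x).
Proof.
rewrite (klin_tsum _ _ comulL) (klin_tsum _ _ (tensor_lact_klin a)).
apply: eq_tsum => b d; rewrite comulE (klin_tsum _ _ (tensor_lact_klin a)).
by apply: eq_tsum => d1 d2; rewrite tensor_lactE -pi_lact lactE.
Qed.

Let comul_psi d b : entw_comulAD (psi (d ⊗ b)) = tensor_ract (entw_comulAD ((1 : A) ⊗ d)) b.
Proof.
have B a : balanced (M := kr D) (N := kl D) (fun d1 d2 => pi (a ⊗ d1) ⊗[A] pi ((1 : A) ⊗ d2)).
  by balanced.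
pose X (t : A ⊗ (D ⊗ D)) :=
  \tsum_(a, w <- t) \tsum_(d1, d2 <- w) pi (a ⊗ d1) ⊗[A] pi ((1 : A) ⊗ d2).
have XB : balanced (M := kr A) (N := kl (D ⊗ D)%type) (fun a w =>
  \tsum_(d1, d2 <- w) pi (a ⊗ d1) ⊗[A] pi ((1 : A) ⊗ d2)) by balanced.
have XL : klin X by apply: tsum_klin.
have -> : entw_comulAD (psi (d ⊗ b)) = X (\tsum_(a, d' <- psi (d ⊗ b)) a ⊗ comul D d').
  by rewrite (klin_tsum _ _ XL); apply: eq_tsum => a d'; rewrite /X tsum_tens.
rewrite entw_comul comulE (klin_tsum _ _ XL) (klin_tsum _ _ (tensor_ract_klin b)).
apply: eq_tsum => d1 d2; rewrite tensor_ractE -pi_ract -psi1 (klin_tsum _ _ XL).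
have GL : klin (fun y => pi ((1 : A) ⊗ d1) ⊗[A] pi y) by klin.
rewrite -[in RHS](tsum_id (psi _)); apply: etrans (esym (klin_tsum _ _ GL)).
apply: eq_tsum => a d2'; rewrite (klin_tsum _ _ XL).
have -> : pi (a ⊗ d2') = a ▹ pi ((1 : A) ⊗ d2') by rewrite -pi_lact lactE mulr1.
rewrite -tens_bal -pi_ract -psi1 -[in RHS](tsum_id (psi _)).
have HL : klin (fun y => pi y ⊗[A] pi ((1 : A) ⊗ d2')) by klin.
apply: etrans (esym (klin_tsum _ _ HL)).
by apply: eq_tsum => a' d1'; rewrite /X !tsum_tens.
Qed.

Let comul_ract x b : entw_comulAD (entw_ract x b) = tensor_ract (entw_comulAD x) b.
Proof.
rewrite (klin_tsum _ _ comulL) -[in RHS](tsum_id x) (klin_tsum _ _ comulL).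
rewrite (klin_tsum _ _ (tensor_ract_klin b)); apply: eq_tsum => a d.
rewrite -/(entw_lact a _) comul_lact comul_psi -tensor_lact_ract -comul_lact lactE.
by rewrite mulr1.
Qed.

Let comul_proj x : entw_comulAD (entw_proj x) = entw_comulAD x.
Proof. by rewrite projE comul_ract tensor_ract1. Qed.

(* a 1_psi ⊗ d^psi |-> (a 1_psi ⊗ d_(1)^psi) ⊗_A (1_psi' ⊗ d_(2)^psi') *)
Definition entw_ccomul (c : C) : C ⊗[A] C := entw_comulAD (val (c : entw_coring_sort)).
Fact entw_ccomul_linear : linear entw_ccomul.
Proof. by move=> t x y; rewrite /entw_ccomul linearP comulL. Qed.
HB.instance Definition _ := GRing.isLinear.Build k C (C ⊗[A] C)%type _
  entw_ccomul entw_ccomul_linear.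

Lemma entw_ccomulE a d : entw_ccomul (pi (a ⊗ d)) =
  \tsum_(d1, d2 <- comul D d) pi (a ⊗ d1) ⊗[A] pi ((1 : A) ⊗ d2).
Proof. by rewrite /entw_ccomul val_to_coring comul_proj comulE. Qed.

Definition entw_counitAD (x : A ⊗ D) : A := \tsum_(a, d <- x) counit D d *: a.
Let counitB : balanced (M := kr A) (N := kl D) (fun a d => counit D d *: a).
Proof. balanced. Qed.
Let counitL : klin entw_counitAD. Proof. exact: tsum_klin. Qed.
Let counit_lact a x : entw_counitAD (entw_lact a x) = a * entw_counitAD x.
Proof.
rewrite (klin_tsum _ _ counitL) (klin_tsum _ _ (@klin_mulr _ _ _ _ a (@klin_id _ _))).
by apply: eq_tsum => b d; rewrite /entw_counitAD tsum_tens // kscalerAr.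
Qed.
Let counit_psi d a : entw_counitAD (psi (d ⊗ a)) = entw_unit psi d * a.
Proof. exact: entw_counit. Qed.
Let counit_ract x a : entw_counitAD (entw_ract x a) = entw_counitAD (entw_proj x) * a.
Proof.
rewrite projE !(klin_tsum _ _ counitL).
rewrite (klin_tsum _ _ (@klin_mull _ _ _ _ a (@klin_id _ _))); apply: eq_tsum => b d.
by rewrite -!/(entw_lact b _) !counit_lact !counit_psi mulr1 mulrA.
Qed.

(* a 1_psi ⊗ d^psi |-> a e(d) *)
Definition entw_ccounit (c : C) : A := entw_counitAD (val (c : entw_coring_sort)).
Fact entw_ccounit_linear : linear entw_ccounit.
Proof. by move=> t x y; rewrite /entw_ccounit linearP counitL. Qed.
HB.instance Definition _ := GRing.isLinear.Build k C A _ entw_ccounit entw_ccounit_linear.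

Lemma entw_ccounitE a d : entw_ccounit (pi (a ⊗ d)) = a * entw_unit psi d.
Proof.
by rewrite /entw_ccounit val_to_coring projE ractE counit_lact counit_psi mulr1.
Qed.

Fact entw_ccomul_lact a c : entw_ccomul (a ▹ c) = tensor_lact a (entw_ccomul c).
Proof. by rewrite /entw_ccomul val_lact comul_lact. Qed.
Fact entw_ccomul_ract c a : entw_ccomul (c ◃ a) = tensor_ract (entw_ccomul c) a.
Proof. by rewrite /entw_ccomul val_ract comul_ract. Qed.
Fact entw_ccounit_lact a c : entw_ccounit (a ▹ c) = a * entw_ccounit c.
Proof. by rewrite /entw_ccounit val_lact counit_lact. Qed.
Fact entw_ccounit_ract c a : entw_ccounit (c ◃ a) = entw_ccounit c * a.
Proof.
rewrite /entw_ccounit val_ract counit_ract; congr (entw_counitAD _ * _).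
exact/entw_rangeP/valP.
Qed.

Let ccomul_ind (P : lmodType k) (f g : C -> P) : klin f -> klin g ->
  (forall a d, f (pi (a ⊗ d)) = g (pi (a ⊗ d))) -> f =1 g.
Proof.
move=> fL gL fg c; rewrite -[c]to_coringK; move: (val _) => x.
have fL' : klin (fun x => f (pi x)) by move=> t y z; rewrite linearP fL.
have gL' : klin (fun x => g (pi x)) by move=> t y z; rewrite linearP gL.
exact: (tensor_ext fL' gL' fg).
Qed.

Fact entw_ccomulA c :
  \tsum_(c1, c2 <- entw_ccomul c) \tsum_(c11, c12 <- entw_ccomul c1)
    c11 ⊗[A]: (c12 ⊗[A] c2)
  = \tsum_(c1, c2 <- entw_ccomul c) c1 ⊗[A]: (entw_ccomul c2).
Proof.
have B1 (c2 : C) : balanced (fun c11 c12 : C => c11 ⊗[A]: (c12 ⊗[A] c2)).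
  split; [klin | klin | move=> x a y].
  by rewrite tens_bal; congr tens; rewrite /= tensor_lactE.
have B2 : balanced (fun c1 c2 : C => \tsum_(c11, c12 <- entw_ccomul c1)
    c11 ⊗[A]: (c12 ⊗[A] c2)).
  split=> [c2|c1|c1 a c2]; last 1 first.
  - rewrite entw_ccomul_ract (klin_tsum _ _ (tsum_klin (B1 c2))).
    by apply: eq_tsum => x y; rewrite tsum_tens // tens_bal.
  - by apply: klin_tsuml; [exact: B1 | klin].
  - klin.
have B3 : balanced (fun c1 c2 : C => c1 ⊗[A]: (entw_ccomul c2)).
  split=> [c2|c1|c1 a c2]; [klin | klin |].
  by rewrite tens_bal entw_ccomul_lact.
move: c; apply: ccomul_ind.
- by apply: klin_tsuml; [exact: B2 | klin].
- by apply: klin_tsuml; [exact: B3 | klin].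
move=> a d; rewrite entw_ccomulE.
rewrite (klin_tsum _ _ (tsum_klin B2)) (klin_tsum _ _ (tsum_klin B3)).
pose F d1 d2 d3 := pi (a ⊗ d1) ⊗[A]: (pi ((1 : A) ⊗ d2) ⊗[A] pi ((1 : A) ⊗ d3)).
apply: etrans (etrans (comul3 (F := F) _ _ _ _) _).
- apply: eq_tsum => d1 d2; rewrite tsum_tens // entw_ccomulE.
  rewrite (klin_tsum _ _ (tsum_klin (B1 _))).
  by apply: eq_tsum => d11 d12; rewrite tsum_tens.
- by move=> d2 d3; rewrite /F; klin.
- by move=> d1 d3; rewrite /F; klin.
- by move=> d1 d2; rewrite /F; klin.
apply: eq_tsum => d1 d2; rewrite tsum_tens // entw_ccomulE.
have L : klin (fun y : C ⊗[A] C => pi (a ⊗ d1) ⊗[A]: y) by klin.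
by rewrite (klin_tsum _ _ L).
Qed.

Fact entw_ccounitl c : \tsum_(c1, c2 <- entw_ccomul c) entw_ccounit c1 ▹ c2 = c.
Proof.
have B : balanced (fun c1 c2 : C => entw_ccounit c1 ▹ c2).
  by split; [klin | klin | move=> x a y; rewrite entw_ccounit_ract lactA].
move: c; apply: (ccomul_ind (g := id)) => // [|a d].
  by apply: klin_tsuml; [exact: B | klin].
rewrite entw_ccomulE (klin_tsum _ _ (tsum_klin B)).
rewrite -[RHS]/(pi (a ⊗ d)) -[RHS]pi_proj projE ractE pi_lact entw_one.
have L : klin (fun y => a ▹ pi y) by klin.
apply: etrans (esym (klin_tsum _ _ L)); apply: eq_tsum => d1 d2.
by rewrite tsum_tens // entw_ccounitE -!pi_lact !lactE mulr1.
Qed.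

Let psi_counitr d :
  \tsum_(d1, d2 <- comul D d) psi (d1 ⊗ entw_unit psi d2) = psi (d ⊗ (1 : A)).
Proof.
have B a : balanced (M := kr D) (N := kl D) (fun d1 d2 => counit D d2 *: ((a : A) ⊗ d1)).
  by balanced.
pose X (t : A ⊗ (D ⊗ D)) :=
  \tsum_(a, w <- t) \tsum_(d1, d2 <- w) counit D d2 *: (a ⊗ d1).
have XB : balanced (M := kr A) (N := kl (D ⊗ D)%type) (fun a w =>
  \tsum_(d1, d2 <- w) counit D d2 *: (a ⊗ d1)) by balanced.
have XL : klin X by apply: tsum_klin.
have := congr1 X (entw_comul psi d 1); rewrite !(klin_tsum _ _ XL) => E.
rewrite -[RHS]tsum_id; apply: etrans (etrans (esym E) _); last first.
  apply: eq_tsum => a d'; rewrite /X tsum_tens //.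
  rewrite -[in RHS](counitr d').
  have L : klin (fun y : D => (a : A) ⊗ y) by klin.
  rewrite (klin_tsum _ _ L); apply: eq_tsum => d1 d2.
  by rewrite tensZr.
apply: eq_tsum => d1 d2; rewrite (klin_tsum _ _ XL).
have L : klin (fun y : A => psi (d1 ⊗ y)) by klin.
rewrite /entw_unit (klin_tsum _ _ L); apply: eq_tsum => a d2'.
rewrite (klin_tsum _ _ XL) tensZr linearZ -[in LHS](tsum_id (psi _)).
have L' : klin (fun y : A ⊗ D => counit D d2' *: y) by klin.
apply: etrans (klin_tsum _ _ L') _.
by apply: eq_tsum => a' d1'; rewrite /X !tsum_tens.
Qed.

Fact entw_ccounitr c : \tsum_(c1, c2 <- entw_ccomul c) c1 ◃ entw_ccounit c2 = c.
Proof.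
have B : balanced (fun c1 c2 : C => c1 ◃ entw_ccounit c2).
  by split; [klin | klin | move=> x a y; rewrite entw_ccounit_lact ractA].
move: c; apply: (ccomul_ind (g := id)) => // [|a d].
  by apply: klin_tsuml; [exact: B | klin].
rewrite entw_ccomulE (klin_tsum _ _ (tsum_klin B)).
rewrite -[RHS]/(pi (a ⊗ d)) -[RHS]pi_proj projE ractE pi_lact -psi_counitr.
have L : klin (fun y => a ▹ pi y) by klin.
apply: etrans (esym (klin_tsum _ _ L)); apply: eq_tsum => d1 d2.
by rewrite tsum_tens // entw_ccounitE mul1r -pi_ract ractE pi_lact.
Qed.

Definition entw_coring : coring A :=
  @Coring k A C entw_ccomul entw_ccounit entw_ccomul_lact entw_ccomul_ract
    entw_ccounit_lact entw_ccounit_ract entw_ccomulA entw_ccounitl entw_ccounitr.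

Definition entw_coactAD (x : A ⊗ D) : C ⊗ D :=
  \tsum_(a, d <- x) \tsum_(d1, d2 <- comul D d) pi (a ⊗ d1) ⊗ d2.
Let coactB : balanced (M := kr A) (N := kl D) (fun a d =>
  \tsum_(d1, d2 <- comul D d) pi (a ⊗ d1) ⊗ d2).
Proof. balanced. Qed.
Let coactL : klin entw_coactAD. Proof. exact: tsum_klin. Qed.
Let coactE a d : entw_coactAD (a ⊗ d) = \tsum_(d1, d2 <- comul D d) pi (a ⊗ d1) ⊗ d2.
Proof. exact: tsum_tens. Qed.

Let coact_proj x : entw_coactAD (entw_proj x) = entw_coactAD x.
Proof.
have pL : klin entw_proj by exact: ract_klin.
move: x; apply: tensor_ext => // [t x y|a d]; first by rewrite pL coactL.
rewrite projE ractE entw_one (klin_tsum _ _ (lact_klin a)) (klin_tsum _ _ coactL).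
pose F d1 d2 d3 := pi ((a * entw_unit psi d1) ⊗ d2) ⊗ (d3 : D).
have unitL : klin (entw_unit psi) by rewrite /entw_unit; klin.
apply: etrans (etrans (esym (comul3 (F := F) d _ _ _)) _).
- apply: eq_tsum => d1 d2; rewrite lactE coactE; exact: eq_tsum.
- move=> d2 d3; rewrite /F; apply: klin_ktensl; apply: klin_linear.
  by apply: klin_ktensl; apply: klin_mulr.
- by move=> d1 d3; rewrite /F; klin.
- by move=> d1 d2; rewrite /F; klin.
rewrite coactE; apply: eq_tsum => d1 d2; rewrite /F -[pi (a ⊗ d1)]pi_proj projE ractE entw_one.
have L : klin (fun y => pi (entw_lact a y) ⊗ (d2 : D)).
  by apply: klin_ktensl; apply: klin_linear.
by rewrite (klin_tsum _ _ L); apply: eq_tsum => d11 d12; rewrite lactE.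
Qed.

(* a 1_psi ⊗ d^psi |-> (a 1_psi ⊗ d_(1)^psi) ⊗ d_(2) *)
Definition entw_coact (c : C) : C ⊗ D := entw_coactAD (val (c : entw_coring_sort)).
Fact entw_coact_linear : linear entw_coact.
Proof. by move=> t x y; rewrite /entw_coact linearP coactL. Qed.
HB.instance Definition _ := GRing.isLinear.Build k C (C ⊗ D)%type _
  entw_coact entw_coact_linear.

Lemma entw_coactE a d : entw_coact (pi (a ⊗ d)) =
  \tsum_(d1, d2 <- comul D d) pi (a ⊗ d1) ⊗ d2.
Proof. by rewrite /entw_coact val_to_coring coact_proj coactE. Qed.

Fact entw_coact_lact a c : entw_coact (a ▹ c)
  = \tsum_(c0, d <- entw_coact c) (a ▹ (c0 : C)) ⊗ d.
Proof.
have B : balanced (M := kr C) (N := kl D) (fun c0 d => (a ▹ (c0 : C)) ⊗ d) by balanced.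
move: c; apply: ccomul_ind => [|| b d]; first klin.
  by apply: klin_tsuml; [exact: B | klin].
rewrite -pi_lact lactE !entw_coactE (klin_tsum _ _ (tsum_klin B)).
by apply: eq_tsum => d1 d2; rewrite tsum_tens // -pi_lact lactE.
Qed.

Fact entw_coact_counit c : \tsum_(c0, d <- entw_coact c) counit D d *: c0 = c.
Proof.
have B : balanced (M := kr C) (N := kl D) (fun c d => counit D d *: c) by balanced.
move: c; apply: (ccomul_ind (g := id)) => // [|a d].
  by apply: klin_tsuml; [exact: B | klin].
rewrite entw_coactE (klin_tsum _ _ (tsum_klin B)).
rewrite -[RHS]/(pi (a ⊗ d)) -[in RHS](counitr d).
have L : klin (fun y : D => pi (a ⊗ y)) by klin.
rewrite (klin_tsum _ _ L); apply: eq_tsum => d1 d2.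
by rewrite tsum_tens // tensZr linearZ.
Qed.

Fact entw_coactA c :
  \tsum_(c0, d <- entw_coact c) \tsum_(c00, d' <- entw_coact c0) c00 ⊗ (d' ⊗ d)
  = \tsum_(c0, d <- entw_coact c) c0 ⊗ comul D d.
Proof.
have B1 : balanced (M := kr C) (N := kl D) (fun c0 d =>
    \tsum_(c00, d' <- entw_coact c0) c00 ⊗ (d' ⊗ d)) by balanced.
have B2 : balanced (M := kr C) (N := kl D) (fun c0 d => c0 ⊗ comul D d) by balanced.
move: c; apply: ccomul_ind => [|| a d].
- by apply: klin_tsuml; [exact: B1 | klin].
- by apply: klin_tsuml; [exact: B2 | klin].
rewrite entw_coactE (klin_tsum _ _ (tsum_klin B1)) (klin_tsum _ _ (tsum_klin B2)).
pose F d1 d2 d3 := pi (a ⊗ d1) ⊗ ((d2 : D) ⊗ (d3 : D)).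
apply: etrans (etrans (comul3 (F := F) _ _ _ _) _).
- apply: eq_tsum => d1 d2; rewrite tsum_tens // entw_coactE.
  have B3 : balanced (M := kr C) (N := kl D) (fun c00 d' => c00 ⊗ (d' ⊗ (d2 : D))).
    by balanced.
  rewrite (klin_tsum _ _ (tsum_klin B3)).
  by apply: eq_tsum => d11 d12; rewrite tsum_tens.
- by move=> d2 d3; rewrite /F; klin.
- by move=> d1 d3; rewrite /F; klin.
- by move=> d1 d2; rewrite /F; klin.
apply: eq_tsum => d1 d2; rewrite tsum_tens //.
have L : klin (fun y : D ⊗ D => pi (a ⊗ d1) ⊗ y) by klin.
rewrite -[in RHS](tsum_id (comul D d2)); apply: esym; exact: (klin_tsum _ _ L).
Qed.

Definition entw_coact_comodule : is_kcomodule (D := D) (M := C) entw_coact :=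
  @IsKcomodule k D C entw_coact entw_coactA entw_coact_counit.

Fact entw_coact_colinear c :
  \tsum_(c0, d <- entw_coact c) entw_ccomul c0 ⊗ d
  = \tsum_(c1, c2 <- entw_ccomul c) \tsum_(c20, d <- entw_coact c2)
      ((c1 : C) ⊗[A] (c20 : C)) ⊗ d.
Proof.
have B1 : balanced (M := kr C) (N := kl D) (fun c0 d => entw_ccomul c0 ⊗ d) by balanced.
have B (c1 : C) : balanced (M := kr C) (N := kl D)
  (fun c20 d => ((c1 : C) ⊗[A] (c20 : C)) ⊗ d) by balanced.
have B2 : balanced (fun c1 c2 : C => \tsum_(c20, d <- entw_coact c2)
    ((c1 : C) ⊗[A] (c20 : C)) ⊗ d).
  split=> [c2|c1|c1 a c2]; [klin | by apply: klin_tsuml; [exact: B | klin] |].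
  rewrite entw_coact_lact (klin_tsum _ _ (tsum_klin (B c1))).
  by apply: eq_tsum => c20 d; rewrite tsum_tens // tens_bal.
move: c; apply: ccomul_ind => [|| a d].
- by apply: klin_tsuml; [exact: B1 | klin].
- by apply: klin_tsuml; [exact: B2 | klin].
rewrite entw_coactE entw_ccomulE.
rewrite (klin_tsum _ _ (tsum_klin B1)) (klin_tsum _ _ (tsum_klin B2)).
pose F d1 d2 d3 := (pi (a ⊗ d1) ⊗[A] pi ((1 : A) ⊗ d2)) ⊗ (d3 : D).
apply: etrans (etrans (comul3 (F := F) _ _ _ _) _).
- apply: eq_tsum => d1 d2; rewrite tsum_tens // entw_ccomulE.
  have L : klin (fun y : C ⊗[A] C => y ⊗ (d2 : D)) by klin.
  by rewrite (klin_tsum _ _ L).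
- by move=> d2 d3; rewrite /F; klin.
- by move=> d1 d3; rewrite /F; klin.
- by move=> d1 d2; rewrite /F; klin.
apply: eq_tsum => d1 d2; rewrite tsum_tens // entw_coactE.
rewrite (klin_tsum _ _ (tsum_klin (B _))).
by apply: eq_tsum => d21 d22; rewrite tsum_tens.
Qed.

Definition entw_extension : pure_extension entw_coring D :=
  @PureExtension k A entw_coring D entw_coact entw_coact_comodule entw_coact_lact
    entw_coact_colinear
    (fun M rho rhoP => rcomodule_preserves_equalizer rhoP (W := (D ⊗ D)%type)).

End AssociatedCoring.

(* Main.v *)
From HB Require Import structures.
Require Import Defs.
From mathcomp Require Import all_boot all_algebra.

(** Both structures on the regular module are governed by one element of [C].

    Since [A ⊗_A C] is [C], a right [C]-coaction on [A] is [a |-> 1 ⊗_A g a]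
    with [g] the image of [1], and the comodule axioms say that [g] is
    grouplike: [Δ g = g ⊗_A g] and [ε g = 1] ([grouplike_rcomodule],
    [rcomodule_grouplike]).  Seen inside [A ⊗ D], the map [a |-> g a] is the
    induced [D]-coaction, and the [D]-coactions which make [A] a weak entwined
    module are exactly those of this form ([grouplike_entwined],
    [entwined_grouplike]).  So the choice of a coaction is on either side the
    choice of a grouplike [g], with [g = 1_[0] ⊗ 1_[1]] as an element of
    [A ⊗ D], and it remains to match the cleaving data for a fixed [g].

    As [A^* = A], a map [q : C -> A^*] is a map [Q : C -> A], namely
    [Q c = q c 1], and it belongs to [Q~] when it is left [A]-linear and
    [c_(1) Q(c_(2)) = Q(c) g].  Left linear maps on [C], the range of the
    projector [a ⊗ d |-> a 1_psi ⊗ d^psi], are the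
    [a 1_psi ⊗ d^psi |-> a λ'(d)] for the maps [λ' : D -> A] with
    [1_psi λ'(d^psi) = λ'(d)].  The other condition of [Q~] at
    [1_psi ⊗ d^psi] reads
    [λ'(d) 1_[0] ⊗ 1_[1] = λ'(d_2)_psi ⊗ d_1^psi], because
    [(1_psi ⊗ d^psi) b = psi (d ⊗ b)].

    For [p = λ], the product is
    [(q • λ)(c) = Q(c_[0]) g λ(c_[1]) = c_(1) (Q(c_(2)[0]) λ(c_(2)[1]))], by the
    left colinearity of the [D]-coaction on [C].  Hence [q • λ = id] if and only
    if [Q(c_[0]) λ(c_[1]) = ε(c)] ([bullet_regular_id]): one direction applies
    [ε] and uses [ε g = 1], the other one is the counit axiom.  At
    [c = a 1_psi ⊗ d^psi] this last identity is
    [a λ'(d_1) λ(d_2) = a e(d)]. *)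

Set Implicit Arguments.
Unset Strict Implicit.
Unset Printing Implicit Defensive.

Import GRing.Theory.
Local Open Scope ring_scope.

(** * Coactions on the regular module and grouplike elements *)

Section Grouplikes.
Variables (k : comPzRingType) (A : kalg k).
Local Notation R := (regular_rmod A).

Lemma regular_lact_balanced (N : lmod A) : balanced (fun (a : R) (n : N) => a ▹ n).
Proof. balanced. Qed.

Lemma regular_tens_inj (N : lmod A) : injective (fun n : N => (1 : R) ⊗[A] n).
Proof.
move=> n n' /(congr1 (fun t : R ⊗[A] N => \tsum_(a, m <- t) a ▹ m)).
by rewrite !(tsum_tens _ _ (regular_lact_balanced N)) !lact1.
Qed.

Lemma regular_tensE (N : lmod A) (t : R ⊗[A] N) :
  t = (1 : R) ⊗[A] (\tsum_(a, n <- t) a ▹ n).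
Proof.
have L : klin (fun n : N => (1 : R) ⊗[A] n) by klin.
rewrite (klin_tsum _ _ L) -[LHS]tsum_id; apply: eq_tsum => a n.
by rewrite -tens_bal /= mul1r.
Qed.

Lemma dual_regular (f : dual R) x : f x = f (1 : R) * x.
Proof. by rewrite -dual_ract /= mul1r. Qed.

Fact mul_dualD (b : A) : {morph (fun x : R => b * x : A) : x y / x + y}.
Proof. by move=> x y; rewrite mulrDr. Qed.
Fact mul_dual_ract (b : A) (x : R) (a : A) : b * (x ◃ a) = (b * x) * a :> A.
Proof. exact: mulrA. Qed.
Definition mul_dual (b : A) : dual R := Dual (@mul_dualD b) (@mul_dual_ract b).

Variable C : coring A.
Implicit Type g : C.

Definition grouplike g : Prop := ccomul C g = g ⊗[A] g /\ ccounit C g = 1.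

Definition regular_coaction g (a : R) : R ⊗[A] C := (1 : R) ⊗[A] (g ◃ a).

Fact regular_coaction_linear g : linear (regular_coaction g).
Proof. by rewrite /regular_coaction; klin. Qed.
HB.instance Definition _ g := GRing.isLinear.Build k R (R ⊗[A] C)%type _
  (regular_coaction g) (regular_coaction_linear g).

Lemma regular_coaction_ract g m a :
  regular_coaction g (m ◃ a) = tensor_ract (regular_coaction g m) a.
Proof. by rewrite /regular_coaction tensor_ractE /= ractA. Qed.

(** The first leg of [1 ⊗_A g m] is [1], so the second application of the
    coaction produces [g] itself. *)
Lemma regular_coaction_twice g m :
  \tsum_(m0, c <- regular_coaction g m) \tsum_(m00, m01 <- regular_coaction g m0)
    m00 ⊗[A]: (m01 ⊗[A] c) = (1 : R) ⊗[A]: (g ⊗[A] (g ◃ m)).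
Proof.
have B1 (c : C) : balanced (fun (m00 : R) (m01 : C) => m00 ⊗[A]: (m01 ⊗[A] c)).
  by split; [klin|klin|move=> x a y; rewrite tens_bal /= tensor_lactE].
have B2 : balanced (fun (m0 : R) (c : C) => \tsum_(m00, m01 <- regular_coaction g m0)
    m00 ⊗[A]: (m01 ⊗[A] c)).
  split=> [c|m0|m0 a c]; last 1 first.
  + rewrite regular_coaction_ract (klin_tsum _ _ (tsum_klin (B1 c))).
    by apply: eq_tsum => x y; rewrite tsum_tens // tens_bal.
  + by apply: klin_tsuml; [exact: B1 | klin].
  + klin.
by rewrite {2}/regular_coaction tsum_tens //= tsum_tens //= ract1.
Qed.

Lemma regular_coaction_comul g m :
  \tsum_(m0, c <- regular_coaction g m) m0 ⊗[A]: (ccomul C c)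
    = (1 : R) ⊗[A]: tensor_ract (ccomul C g) m.
Proof.
have B : balanced (fun (m0 : R) (c : C) => m0 ⊗[A]: (ccomul C c)).
  by split=> [c|m0|m0 a c]; [klin|klin|rewrite tens_bal ccomul_lact].
by rewrite tsum_tens // ccomul_ract.
Qed.

Lemma regular_coaction_counit g m :
  \tsum_(m0, c <- regular_coaction g m) m0 ◃ ccounit C c = ccounit C g * m.
Proof.
have B : balanced (fun (m0 : R) (c : C) => m0 ◃ ccounit C c).
  by split; [klin|klin|move=> x a c; rewrite /= ccounit_lact mulrA].
by rewrite tsum_tens //= ccounit_ract mul1r.
Qed.

Lemma grouplike_rcomodule g : grouplike g -> is_rcomodule (regular_coaction g).
Proof.
case=> gD ge; split=> [m a|m|m]; first exact: regular_coaction_ract.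
- by rewrite [LHS]regular_coaction_twice [RHS]regular_coaction_comul gD tensor_ractE.
- by rewrite [LHS]regular_coaction_counit ge mul1r.
Qed.

(** The grouplike element is the image of [1] under [A ⊗_A C = C]; right
    linearity of the coaction then determines it everywhere, and the comodule
    axioms at [1] are those of a grouplike element. *)
Lemma rcomodule_grouplike (rho : {linear R -> (R ⊗[A] C)%type}) :
  is_rcomodule rho -> exists2 g, grouplike g & forall a, rho a = regular_coaction g a.
Proof.
move=> [rhoZ rhoA rho1]; pose g := \tsum_(a, c <- rho 1) a ▹ c.
have rhoE a : rho a = regular_coaction g a.
  have -> : a = (1 : R) ◃ a by rewrite /= mul1r.
  by rewrite rhoZ (regular_tensE (rho 1)) regular_coaction_ract /regular_coaction ract1.
exists g => //; split.
- have := rhoA 1; rewrite rhoE [RHS]regular_coaction_comul tensor_ract1 => E.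
  apply: (@regular_tens_inj (tensor_lmod C C)); rewrite -E.
  apply: etrans (_ : _ = (1 : R) ⊗[A]: (g ⊗[A] (g ◃ (1 : A)))) _; last by rewrite ract1.
  rewrite -[RHS]regular_coaction_twice; apply: eq_tsum => m0 c.
  by rewrite rhoE.
- by have := rho1 1; rewrite rhoE regular_coaction_counit mulr1.
Qed.

End Grouplikes.

(** * Right extensions: the induced coaction and the product of Q~ *)

Section RegularExtension.
Variables (k : comPzRingType) (A : kalg k) (C : coring A) (D : coalgebra k).
Variable ext : pure_extension C D.
Local Notation R := (regular_rmod A).
Local Notation coact := (ext_coact ext).

(** Left colinearity of the [D]-coaction on [C], in the form in which it is used:
    it commutes with the coproduct under any trilinear balanced expression. *)
Lemma ext_colinear_sum (P : lmodType k) (G : C -> C -> D -> P) c :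
  (forall d, balanced (fun c1 c2 => G c1 c2 d)) ->
  (forall c1 c2, klin (G c1 c2)) ->
  \tsum_(c0, d <- coact c) \tsum_(c1, c2 <- ccomul C c0) G c1 c2 d
  = \tsum_(c1, c2 <- ccomul C c) \tsum_(c20, d <- coact c2) G c1 c20 d.
Proof.
move=> Gb Gl.
have B : balanced (M := kr (C ⊗[A] C)%type) (N := kl D)
    (fun t d => \tsum_(c1, c2 <- t) G c1 c2 d).
  apply: balancedk => [d|t]; first exact: tsum_klin.
  exact: klin_tsumr.
have L := tsum_klin B.
have := congr1 (fun t : (C ⊗[A] C) ⊗ D => \tsum_(u, d <- t) \tsum_(c1, c2 <- u) G c1 c2 d)
  (ext_colinear ext c).
rewrite !(klin_tsum _ _ L) => E; apply: etrans (etrans E _).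
  by apply: eq_tsum => c0 d; rewrite tsum_tens.
apply: eq_tsum => c1 c2; rewrite (klin_tsum _ _ L); apply: eq_tsum => c20 d.
by rewrite !tsum_tens.
Qed.

(** The first leg of the [D]-coaction collapsed by the counit.  For the coring of
    a weak entwining structure this is the inclusion of [C] in [A ⊗ D], see
    [coring_val_coact]. *)
Definition coact_counit (c : C) : A ⊗ D := \tsum_(c0, d <- coact c) ccounit C c0 ⊗ d.

Fact coact_counit_linear : linear coact_counit.
Proof. by rewrite /coact_counit; klin. Qed.
HB.instance Definition _ := GRing.isLinear.Build k C (A ⊗ D)%type _
  coact_counit coact_counit_linear.

Lemma tsum_coact_counit (P : lmodType k) (f : A -> D -> P) (c : C) :
  (forall d, klin (f^~ d)) -> (forall a, klin (f a)) ->
  \tsum_(a, d <- coact_counit c) f a d = \tsum_(c0, d <- coact c) f (ccounit C c0) d.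
Proof.
move=> fl fr; have B : balanced (M := kr A) (N := kl D) f by apply: balancedk.
rewrite (klin_tsum _ _ (tsum_klin B)); apply: eq_tsum => c0 d.
by rewrite tsum_tens.
Qed.

(** Coassociativity: the left side applies [a |-> g a] again to the first leg
    [ε(c_[0])] of [c = g b], that is, it evaluates [c_1 ε(c_2[0]) ⊗ c_2[1]] at
    [Δ c = g ⊗_A c].  Left colinearity moves the [D]-coaction in front of [Δ], the
    counit axiom of [C] then removes [Δ], and what is left is coassociativity of
    the [D]-coaction on [C]. *)
Lemma coact_counit_comodule (rho : {linear R -> (R ⊗ D)%type}) g : grouplike g ->
  (forall a, rho a = coact_counit (g ◃ a)) -> is_kcomodule rho.
Proof.
move=> [gD ge] rhoE.
pose spl (x : A ⊗ D) (d : D) : A ⊗ (D ⊗ D) := \tsum_(a, d' <- x) a ⊗ (d' ⊗ d).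
have splB (d : D) : balanced (M := kr A) (N := kl D) (fun a d' => a ⊗ (d' ⊗ d)).
  by balanced.
have splL d : klin (spl^~ d) by apply: tsum_klin.
have splR x : klin (spl x) by rewrite /spl; klin.
pose G (c1 c2 : C) d := spl (coact_counit (c1 ◃ ccounit C c2)) d.
have Gl (c : C) (d : D) : klin (fun a : A => spl (coact_counit (c ◃ a)) d).
  by move=> t x y; rewrite ractDr ractZr linearP splL.
have GB (d : D) : balanced (fun c1 c2 => G c1 c2 d).
  rewrite /G; split=> [c2|c1|c1 a c2].
  - by move=> t x y; rewrite ractDl ractZl linearP splL.
  - by move=> t x y; rewrite linearP Gl.
  - by rewrite ractA ccounit_lact.
have GR (c1 c2 : C) : klin (G c1 c2) by move=> t x y; rewrite /G splR.
split=> [b|b].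
- apply: etrans (_ : _ = \tsum_(a, d <- coact_counit (g ◃ b)) spl (coact_counit (g ◃ a)) d) _.
    by rewrite -rhoE; apply: eq_tsum => a d; rewrite rhoE.
  apply: etrans (_ : _ = \tsum_(a, d <- coact_counit (g ◃ b)) a ⊗ comul D d) _; last first.
    by rewrite -rhoE.
  rewrite !tsum_coact_counit => //; try klin.
  have B : balanced (fun c1 c2 : C => \tsum_(c20, d <- coact c2) G c1 c20 d).
    split=> [c2|c1|c1 a c2]; [by klin | |].
    + apply: klin_tsuml; last klin.
      apply: balancedk => // d t x y; exact: (balanced_r (GB d) c1).
    + rewrite ext_lact.
      have B : balanced (M := kr C) (N := kl D) (fun c d => G c1 c d).
        by apply: balancedk => // d t x y; exact: (balanced_r (GB d) c1).
      rewrite (klin_tsum _ _ (tsum_klin B)); apply: eq_tsum => c d.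
      by rewrite tsum_tens // (balanced_a (GB d)).
  (* [g ⊗_A g b] is the coproduct of [g b]. *)
  apply: etrans (_ : _ = \tsum_(c1, c2 <- ccomul C (g ◃ b))
      \tsum_(c20, d <- coact c2) G c1 c20 d) _.
    by rewrite ccomul_ract gD tensor_ractE tsum_tens.
  rewrite -ext_colinear_sum //.
  apply: etrans (_ : _ = \tsum_(c0, d <- coact (g ◃ b))
      \tsum_(c00, d' <- coact c0) ccounit C c00 ⊗ (d' ⊗ d)) _.
    apply: eq_tsum => c0 d.
    have L : klin (fun c : C => spl (coact_counit c) d).
      by move=> t x y; rewrite linearP splL.
    apply: etrans (esym (klin_tsum _ _ L)) _.
    by rewrite ccounitr /spl tsum_coact_counit //; klin.
  have B' : balanced (M := kr C) (N := kl (D ⊗ D)%type)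
      (fun c w => ccounit C c ⊗ w) by balanced.
  have L := tsum_klin B'.
  have := congr1 (fun t : C ⊗ (D ⊗ D) => \tsum_(c, w <- t) ccounit C c ⊗ w)
    (kcomoduleA (ext_comodule ext) (g ◃ b)).
  rewrite !(klin_tsum _ _ L) => E; apply: etrans (etrans E _).
    apply: eq_tsum => c0 d; rewrite (klin_tsum _ _ L); apply: eq_tsum => c00 d'.
    by rewrite tsum_tens.
  by apply: eq_tsum => c0 d; rewrite tsum_tens.
- have L : klin (ccounit C) by klin.
  have := congr1 (ccounit C) (kcomodule_counit (ext_comodule ext) (g ◃ b)).
  rewrite ccounit_ract ge mul1r (klin_tsum _ _ L) => E.
  apply: etrans E; rewrite rhoE; apply: etrans (tsum_coact_counit _ _ _) _; [klin | klin |].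
  by apply: eq_tsum => c0 d; rewrite linearZ.
Qed.

Section RegularCoaction.
Variables (g : C) (rho : {linear R -> (R ⊗[A] C)%type}).
Hypothesis gP : grouplike g.
Hypothesis rhoE : forall a, rho a = regular_coaction g a.

Lemma induced_regular a : induced_coaction ext rho a = coact_counit (g ◃ a).
Proof.
rewrite /induced_coaction rhoE tsum_tens; last exact: induced_balanced.
by apply: eq_tsum => c d; rewrite /= mul1r.
Qed.

Lemma tsum_rho_dual (f : dual R) a :
  \tsum_(x0, x1 <- rho a) f x0 ▹ x1 = f (1 : R) ▹ (g ◃ a).
Proof. by rewrite rhoE tsum_tens //; exact: Qtilde_balancedr. Qed.

(** With [Q c = q c 1], the product is [Q(c_[0]) g j(c_[1])].  The condition
    defining [Q~] turns [Q(c_[0]) g] into [c_[0](1) Q(c_[0](2))], and left colinearity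
    moves the [D]-coaction to the second leg of the coproduct. *)
Lemma bullet_regular q (j : {linear D -> R}) c : in_Qtilde rho q ->
  bullet ext rho q j c
  = \tsum_(c1, c2 <- ccomul C c) c1 ◃ \tsum_(c20, d <- coact c2) (q c20 (1 : R) * j d).
Proof.
move=> qP; have qL x : klin (fun c => q c x) by exact: Qtilde_klin qP.
pose G (c1 c2 : C) d := c1 ◃ q c2 (j d).
have GB (d : D) : balanced (fun c1 c2 => G c1 c2 d) by apply: Qtilde_balancedl qP.
have GR (c1 c2 : C) : klin (G c1 c2).
  by apply: klin_ractr => t x y; rewrite linearP dual_klin.
apply: etrans (_ : _ = \tsum_(c0, d <- coact c) \tsum_(c1, c2 <- ccomul C c0) G c1 c2 d) _.
  by apply: eq_tsum => c0 d; rewrite -(Qtilde_coact qP).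
rewrite ext_colinear_sum //; apply: eq_tsum => c1 c2.
have L : klin (fun a : A => c1 ◃ a) by klin.
rewrite (klin_tsum _ _ L); apply: eq_tsum => c20 d.
by rewrite /G dual_regular.
Qed.

(** From left to right apply the counit, which sends [g] to [1]; from right to
    left [bullet_regular] reduces to the counit axiom [c_1 ε(c_2) = c]. *)
Lemma bullet_regular_id q (j : {linear D -> R}) : in_Qtilde rho q ->
  (forall c, bullet ext rho q j c = c) <->
  (forall c, \tsum_(c0, d <- coact c) (q c0 (1 : R) * j d) = ccounit C c).
Proof.
case: gP => _ ge qP; split=> idE c.
- have L : klin (ccounit C) by klin.
  rewrite -[in RHS](idE c) (klin_tsum _ _ L); apply: eq_tsum => c0 d.
  by rewrite tsum_rho_dual ccounit_lact ccounit_ract ge mul1r.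
- rewrite bullet_regular // -[RHS]ccounitr; apply: eq_tsum => c1 c2.
  by rewrite idE.
Qed.

(** The defining condition of [Q~] need only be tested at [x = 1], because both
    of its sides are right [A]-linear in [x]. *)
Lemma Qtilde_mul_dual (Q : C -> A) :
  {morph Q : x y / x + y} -> (forall a c, Q (a ▹ c) = a * Q c) ->
  (forall c, \tsum_(c1, c2 <- ccomul C c) c1 ◃ Q c2 = Q c ▹ g) ->
  in_Qtilde rho (fun c => mul_dual (Q c)).
Proof.
move=> QD Ql Qg; split=> [c c' x|a c x|c x] /=.
- by rewrite QD mulrDl.
- by rewrite Ql mulrA.
- rewrite (tsum_rho_dual (mul_dual (Q c))) /= mulr1 -lact_ract -Qg.
  have L : klin (fun c : C => c ◃ x) by klin.
  by rewrite (klin_tsum _ _ L); apply: eq_tsum => c1 c2; rewrite ractA.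
Qed.

End RegularCoaction.

End RegularExtension.

(** * The coring of a weak entwining structure inside A ⊗ D *)

Section EntwinedCoring.
Variables (k : comPzRingType) (A : kalg k) (D : coalgebra k) (psi : weak_entwining A D).
Local Notation C := (entw_coring psi).
Local Notation pi := (to_coring psi).
Local Notation eract := (entw_ract psi).

Definition coring_val (c : C) : A ⊗ D := val (c : entw_coring_sort psi).

Fact coring_val_linear : linear coring_val.
Proof. by move=> t x y; rewrite /coring_val linearP. Qed.
HB.instance Definition _ := GRing.isLinear.Build k C (A ⊗ D)%type _
  coring_val coring_val_linear.

Lemma coring_val_inj : injective coring_val.
Proof. exact: val_inj. Qed.
Lemma coring_valK c : pi (coring_val c) = c. Proof. exact: to_coringK. Qed.
Lemma coring_val_pi x : coring_val (pi x) = eract x 1. Proof. by []. Qed.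
Lemma coring_val_lact a (c : C) : coring_val (a ▹ c) = entw_lact a (coring_val c).
Proof. by []. Qed.
Lemma coring_val_ract (c : C) (a : A) : coring_val (c ◃ a) = eract (coring_val c) a.
Proof. by []. Qed.

Lemma entw_lactE (a b : A) (d : D) : entw_lact a (b ⊗ d) = (a * b) ⊗ d.
Proof. by rewrite /entw_lact tsum_tens //; balanced. Qed.
Lemma entw_lact_klin a : klin (@entw_lact k A D a).
Proof. by rewrite /entw_lact; klin. Qed.
Lemma entw_ract_klin a : klin (eract^~ a).
Proof. by rewrite /entw_ract; klin. Qed.
Lemma entw_ractE (b : A) (d : D) (a : A) : eract (b ⊗ d) a = entw_lact b (psi (d ⊗ a)).
Proof. by rewrite /entw_ract tsum_tens //; balanced. Qed.
Lemma entw_ract1 (d : D) (a : A) : eract ((1 : A) ⊗ d) a = psi (d ⊗ a).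
Proof.
rewrite entw_ractE -[RHS]tsum_id; apply: eq_tsum => x y.
by rewrite mul1r.
Qed.
Lemma entw_lactA (a b : A) (x : A ⊗ D) : entw_lact a (entw_lact b x) = entw_lact (a * b) x.
Proof.
rewrite (klin_tsum _ _ (entw_lact_klin a)); apply: eq_tsum => c d.
by rewrite entw_lactE mulrA.
Qed.
Lemma entw_lact_ract a x b : eract (entw_lact a x) b = entw_lact a (eract x b).
Proof.
rewrite (klin_tsum _ _ (entw_ract_klin b)) (klin_tsum _ _ (entw_lact_klin a)).
by apply: eq_tsum => c d; rewrite entw_ractE -entw_lactA.
Qed.
Lemma entw_ractA x a b : eract (eract x a) b = eract x (a * b).
Proof.
rewrite (klin_tsum _ _ (entw_ract_klin b)); apply: eq_tsum => c d.
rewrite -/(entw_lact c _) entw_lact_ract -/(entw_lact c _) entw_mul.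
by congr entw_lact.
Qed.

Lemma to_coring_lact a x : pi (entw_lact a x) = a ▹ pi x.
Proof. by apply: coring_val_inj; rewrite coring_val_lact !coring_val_pi entw_lact_ract. Qed.
Lemma to_coring_ract x a : pi (eract x a) = pi x ◃ a.
Proof.
by apply: coring_val_inj; rewrite coring_val_ract !coring_val_pi !entw_ractA mul1r mulr1.
Qed.
Lemma to_coringE (a : A) (d : D) : pi (a ⊗ d) = a ▹ pi ((1 : A) ⊗ d).
Proof. by rewrite -to_coring_lact entw_lactE mulr1. Qed.
Lemma to_coring_psi (d : D) (a : A) : pi (psi (d ⊗ a)) = pi ((1 : A) ⊗ d) ◃ a.
Proof. by rewrite -entw_ract1 to_coring_ract. Qed.
(** The element [1 ⊗ d] need not lie in [C], but the projection onto [C] is right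
    multiplication by [1], so it keeps the right translates by [a]. *)
Lemma coring_val_psi (d : D) (a : A) : coring_val (pi ((1 : A) ⊗ d) ◃ a) = psi (d ⊗ a).
Proof. by rewrite coring_val_ract coring_val_pi entw_ractA mul1r entw_ract1. Qed.

Lemma coring_ext (P : lmodType k) (f g : C -> P) : klin f -> klin g ->
  (forall (a : A) (d : D), f (pi (a ⊗ d)) = g (pi (a ⊗ d))) -> f =1 g.
Proof.
move=> fL gL fg c; rewrite -[c]coring_valK; move: (coring_val _) => x.
have fL' : klin (fun x => f (pi x)) by move=> t y z; rewrite linearP fL.
have gL' : klin (fun x => g (pi x)) by move=> t y z; rewrite linearP gL.
exact: (tensor_ext fL' gL' fg).
Qed.

(** This is [psi (d ⊗ 1) = e(d_1) ⊗ d_2]. *)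
Lemma coring_val_coact c : coring_val c = coact_counit (entw_extension psi) c.
Proof.
move: c; apply: coring_ext => [||a d]; [klin | klin |].
have B : balanced (M := kr C) (N := kl D) (fun (c0 : C) d => entw_ccounit c0 ⊗ d).
  by balanced.
rewrite /coact_counit /= entw_coactE (klin_tsum _ _ (tsum_klin B)).
rewrite coring_val_pi entw_ractE entw_one (klin_tsum _ _ (entw_lact_klin a)).
apply: eq_tsum => d1 d2.
by rewrite tsum_tens // entw_ccounitE entw_lactE.
Qed.

End EntwinedCoring.

(** * Weak entwined structures on the regular module *)

Section Cleft.
Variables (k : comPzRingType) (A : kalg k) (D : coalgebra k) (psi : weak_entwining A D).
Local Notation R := (regular_rmod A).
Local Notation C := (entw_coring psi).
Local Notation ext := (entw_extension psi).
Local Notation pi := (to_coring psi).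

Lemma grouplike_entwined (g : C) (rho : {linear R -> (R ⊗ D)%type}) :
  grouplike g -> (forall a, rho a = coring_val (g ◃ a)) -> is_entwined_module psi rho.
Proof.
move=> gP rhoE; split=> [|m a].
  apply: (coact_counit_comodule (ext := ext) gP) => a.
  by rewrite rhoE coring_val_coact.
have -> : rho (m ◃ a) = entw_ract psi (coring_val (g ◃ m)) a.
  by rewrite rhoE -coring_val_ract ractA.
by rewrite -rhoE.
Qed.

(** Compatibility with [a = 1 a] gives [rho a = (rho 1) a], so that [rho 1] lies in
    [C] and generates the coaction.  Its coproduct is
    [1_[0] ⊗ 1_[1](1) ⊗ 1_[1](2)] read in [C ⊗_A C], which coassociativity
    rewrites as [g 1_[0] ⊗_A (1 ⊗ 1_[1]) = g ⊗_A (1_[0] ⊗ 1_[1])]. *)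
Lemma entwined_grouplike (rho : {linear R -> (R ⊗ D)%type}) :
  is_entwined_module psi rho ->
  exists2 g : C, grouplike g & forall a, rho a = coring_val (g ◃ a).
Proof.
move=> [[rhoA rho_counit] rhoM].
have rhoE (a : A) : rho a = entw_ract psi (rho 1) a.
  by rewrite -[in LHS](mul1r a) [LHS]rhoM.
pose g : C := pi (rho 1).
have gE : coring_val g = rho 1 by rewrite coring_val_pi -rhoE.
have piE (a : A) : pi (rho a) = g ◃ a by rewrite rhoE to_coring_ract.
exists g; last by move=> a; rewrite coring_val_ract gE -rhoE.
split; last first.
  apply: etrans (rho_counit 1).
  by rewrite /= /entw_ccounit -/(coring_val g) gE.
have B (a : A) : balanced (M := kr D) (N := kl D) (fun d1 d2 =>
    (pi (a ⊗ d1) : C) ⊗[A] (pi ((1 : A) ⊗ d2) : C)).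
  by balanced.
(* [X] sends [a ⊗ Δ d] to the coproduct of [a 1_psi ⊗ d^psi]. *)
pose X (t : A ⊗ (D ⊗ D)) :=
  \tsum_(a, w <- t) \tsum_(d1, d2 <- w) (pi (a ⊗ d1) : C) ⊗[A] (pi ((1 : A) ⊗ d2) : C).
have XB : balanced (M := kr A) (N := kl (D ⊗ D)%type) (fun a w =>
  \tsum_(d1, d2 <- w) (pi (a ⊗ d1) : C) ⊗[A] (pi ((1 : A) ⊗ d2) : C)) by balanced.
have XL : klin X by apply: tsum_klin.
have := congr1 X (rhoA 1).
rewrite !(klin_tsum _ _ XL) => E.
have L2 (d : D) : klin (fun x : A ⊗ D => (pi x : C) ⊗[A] (pi ((1 : A) ⊗ d) : C)) by klin.
apply: etrans (etrans (esym E) _).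
  rewrite /= /entw_ccomul -/(coring_val g) gE; apply: eq_tsum => a d.
  by rewrite /X tsum_tens.
have L3 : klin (fun x : A ⊗ D => g ⊗[A] (pi x : C)) by klin.
apply: etrans (_ : _ = \tsum_(a, d <- rho 1) g ⊗[A] (pi (a ⊗ d) : C)) _; last first.
  by apply: etrans (esym (klin_tsum _ _ L3)) _; rewrite tsum_id.
apply: eq_tsum => a d; rewrite (klin_tsum _ _ XL) to_coringE -tens_bal -piE.
rewrite -[rho a in RHS]tsum_id; apply: etrans (esym (klin_tsum _ _ (L2 d))).
by apply: eq_tsum => a' d'; rewrite /X !tsum_tens.
Qed.

(** * Cleaving data for a fixed coaction *)

Lemma tsum_entw_coact (q : C -> A) (p : D -> A) (a : A) (d : D) :
  (forall b (c : C), q (b ▹ c) = b * q c) -> klin q -> klin p ->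
  \tsum_(c0, d' <- ext_coact ext (pi (a ⊗ d))) (q c0 * p d')
  = a * \tsum_(d1, d2 <- comul D d) q (pi ((1 : A) ⊗ d1)) * p d2.
Proof.
move=> ql qL pL; rewrite /= entw_coactE.
have B : balanced (M := kr C) (N := kl D) (fun c d => q c * p d).
  by apply: balancedk => [d'|c]; [apply: klin_mull | apply: klin_mulr].
have L : klin (fun b : A => a * b) by klin.
rewrite (klin_tsum _ _ (tsum_klin B)) (klin_tsum _ _ L); apply: eq_tsum => d1 d2.
by rewrite tsum_tens // [in LHS]to_coringE ql mulrA.
Qed.

(** The restriction to [C] of the left [A]-linear extension of [lamb] to [A ⊗ D].
    Its value at [1_psi ⊗ d^psi] is [1_psi lamb(d^psi)], so it gives back [lamb]
    exactly when [lamb] is normalized. *)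
Definition coring_extend (lamb : D -> A) (c : C) : A :=
  \tsum_(a, d <- coring_val c) a * lamb d.

Lemma coring_extend_balanced (lamb : {linear D -> A}) :
  balanced (M := kr A) (N := kl D) (fun a d => a * lamb d).
Proof. balanced. Qed.

Lemma coring_extend_klin (lamb : {linear D -> A}) : klin (coring_extend lamb).
Proof. by apply: klin_tsuml; [exact: coring_extend_balanced | klin]. Qed.

Lemma coring_extend_lact (lamb : {linear D -> A}) (a : A) (c : C) :
  coring_extend lamb (a ▹ c) = a * coring_extend lamb c.
Proof.
have B := coring_extend_balanced lamb.
have L : klin (fun b : A => a * b) by klin.
rewrite /coring_extend coring_val_lact (klin_tsum _ _ (tsum_klin B)).
by rewrite (klin_tsum _ _ L); apply: eq_tsum => b d; rewrite tsum_tens // mulrA.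
Qed.

Section FixedCoaction.
Variables (g : C) (rhoD : {linear R -> (R ⊗ D)%type}).
Variable rhoC : {linear R -> (R ⊗[A] C)%type}.
Hypothesis gP : grouplike g.
Hypothesis rhoDE : forall a, rhoD a = coring_val (g ◃ a).
Hypothesis rhoCE : forall a, rhoC a = regular_coaction g a.

Lemma induced_colinear (p : {linear D -> R}) :
  colinear (induced_coaction ext rhoC) p <-> colinear rhoD p.
Proof.
have indE a : induced_coaction ext rhoC a = rhoD a.
  by rewrite (induced_regular _ rhoCE) -coring_val_coact rhoDE.
by split=> pP d; have := pP d; rewrite indE.
Qed.

(** Both sides of the condition of [Q~] are linear, so it suffices to compare
    them at [a 1_psi ⊗ d^psi], where it is the first condition on [lamb]. *)
Lemma coring_extend_Qtilde (lamb : {linear D -> A}) :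
  (forall d, coring_extend lamb (pi ((1 : A) ⊗ d)) = lamb d) ->
  (forall d, \tsum_(a, d' <- rhoD (1 : A)) (lamb d * a) ⊗ d'
     = \tsum_(d1, d2 <- comul D d) psi (d1 ⊗ lamb d2)) ->
  in_Qtilde rhoC (fun c => mul_dual (coring_extend lamb c)).
Proof.
set Q := coring_extend lamb => QE lambP.
have QL : klin Q by exact: coring_extend_klin.
have Ql (a : A) (c : C) : Q (a ▹ c) = a * Q c by exact: coring_extend_lact.
apply: (Qtilde_mul_dual rhoCE) => // [x y|c]; first exact: klinD.
have B : balanced (fun c1 c2 : C => c1 ◃ Q c2).
  split=> [c2|c1|c1 a c2]; [klin | by apply: klin_ractr | by rewrite Ql ractA].
move: c; apply: coring_ext => [||a d].
- by apply: klin_tsuml => //; klin.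
- by apply: klin_lactl.
rewrite [ccomul _ _]entw_ccomulE (klin_tsum _ _ (tsum_klin B)).
rewrite [in RHS]to_coringE Ql QE -lactA.
(* [g] is the class of [rhoD 1], to which the hypothesis on [lamb] applies. *)
rewrite -[g in RHS]ract1 -[g ◃ 1]coring_valK -rhoDE -to_coring_lact.
have L : klin (fun x : A ⊗ D => a ▹ (pi x : C)) by klin.
rewrite /entw_lact [X in to_coring _ X]lambP (klin_tsum _ _ L).
apply: eq_tsum => d1 d2.
by rewrite tsum_tens // QE [in LHS]to_coringE lact_ract to_coring_psi.
Qed.

Lemma cleft_via_weak_cleft :
  is_rcomodule rhoC -> cleft_via psi rhoD -> weak_cleft_via ext rhoC.
Proof.
move=> rhoCP [_ [lam [lamb [lamP lamb1 lamb2 lamb3]]]]; split => //.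
pose Q := coring_extend lamb.
have QL : klin Q by exact: coring_extend_klin.
have Ql (a : A) (c : C) : Q (a ▹ c) = a * Q c by exact: coring_extend_lact.
have QE (d : D) : Q (pi ((1 : A) ⊗ d)) = lamb d.
  by rewrite /Q /coring_extend coring_val_pi entw_ract1 lamb2.
have qP := coring_extend_Qtilde QE lamb1.
exists lam, (fun c => mul_dual (Q c)); split=> //; first exact/induced_colinear.
apply/(bullet_regular_id ext gP rhoCE lam qP) => c.
apply: etrans (_ : _ = \tsum_(c0, d <- ext_coact ext c) (Q c0 * lam d)) _.
  by apply: eq_tsum => c0 d; rewrite /= mulr1.
move: c; apply: coring_ext => [||a d]; [|klin|].
  apply: klin_tsuml; last klin.
  by apply: balancedk => [d|c]; [apply: klin_mull | klin].
rewrite tsum_entw_coact //; last klin.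
rewrite [RHS]entw_ccounitE -lamb3; congr (_ * _); apply: eq_tsum => d1 d2.
by rewrite QE.
Qed.

(** The map [lamb] is the restriction of [Q c = q c 1] along
    [d |-> 1_psi ⊗ d^psi]. *)
Lemma weak_cleft_cleft_via : weak_cleft_via ext rhoC -> cleft_via psi rhoD.
Proof.
move=> [_ [j [q [jP qP bulletE]]]]; split; first exact: grouplike_entwined gP rhoDE.
pose Q c := q c (1 : R).
have QL : klin Q by exact: Qtilde_klin qP.
have Ql a c : Q (a ▹ c) = a * Q c by exact: Qtilde_lact qP _ _ _.
have lambL : linear (fun d : D => Q (pi ((1 : A) ⊗ d))).
  by move=> t x y; rewrite tensDr tensZr linearP QL.
pose lamb : {linear D -> A} :=
  HB.pack (fun d : D => Q (pi ((1 : A) ⊗ d))) (GRing.isLinear.Build _ _ _ _ _ lambL).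
exists j, lamb; split=> [|d|d|d]; first exact/induced_colinear.
- have := Qtilde_coact qP (pi ((1 : A) ⊗ d)) (1 : R).
  rewrite (tsum_rho_dual rhoCE) ract1 => /(congr1 (@coring_val _ _ _ psi)).
  rewrite coring_val_lact => E.
  rewrite rhoDE ract1; apply: etrans (esym E) _.
  have B : balanced (fun c1 c2 : C => c1 ◃ Q c2) by exact: Qtilde_balancedl qP.
  have L : klin (@coring_val _ _ _ psi) by klin.
  rewrite /= entw_ccomulE (klin_tsum _ _ (tsum_klin B)) (klin_tsum _ _ L).
  by apply: eq_tsum => d1 d2; rewrite tsum_tens // coring_val_psi.
- have L : klin (fun x : A ⊗ D => Q (pi x)) by move=> t x y; rewrite linearP QL.
  (* [psi (d ⊗ 1)] and [1 ⊗ d] have the same class in [C]. *)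
  rewrite -[RHS]/(Q (pi ((1 : A) ⊗ d))) -[pi _ in RHS]ract1 -to_coring_psi.
  rewrite -[psi _ in RHS]tsum_id.
  apply: etrans (esym (klin_tsum _ _ L)); apply: eq_tsum => a d'.
  by rewrite [in RHS]to_coringE Ql.
- have := (bullet_regular_id ext gP rhoCE j qP).1 bulletE (pi ((1 : A) ⊗ d)).
  rewrite tsum_entw_coact //; last klin.
  by rewrite /= entw_ccounitE !mul1r.
Qed.

End FixedCoaction.

End Cleft.

Theorem proposition6p3 (k : comPzRingType) (A : kalg k) (D : coalgebra k)
    (psi : weak_entwining A D) :
  (cleft psi <-> weak_cleft_bicomodule (entw_extension psi) (regular_rmod A))
  /\
  (forall (rhoD : {linear regular_rmod A -> (regular_rmod A ⊗ D)%type})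
          (rhoC : {linear regular_rmod A -> (regular_rmod A ⊗[A] entw_coring psi)%type}),
     is_rcomodule rhoC ->
     (forall a, rhoD a = induced_coaction (entw_extension psi) rhoC a) ->
     (cleft_via psi rhoD <-> weak_cleft_via (entw_extension psi) rhoC)).
Proof.
have same (rhoD : {linear regular_rmod A -> (regular_rmod A ⊗ D)%type})
    (rhoC : {linear regular_rmod A -> (regular_rmod A ⊗[A] entw_coring psi)%type}) :
    is_rcomodule rhoC ->
    (forall a, rhoD a = induced_coaction (entw_extension psi) rhoC a) ->
    cleft_via psi rhoD <-> weak_cleft_via (entw_extension psi) rhoC.
  move=> rhoCP rhoDE; have [g gP rhoCE] := rcomodule_grouplike rhoCP.
  have rhoDg a : rhoD a = coring_val (g ◃ a).
    by rewrite rhoDE (induced_regular _ rhoCE) coring_val_coact.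
  split; first exact: (cleft_via_weak_cleft gP rhoDg rhoCE rhoCP).
  exact: (weak_cleft_cleft_via gP rhoDg rhoCE).
split=> //; split=> [[rhoD cleftP] | [rhoC cleftP]].
- have [g gP rhoDE] := entwined_grouplike cleftP.1.
  exists (regular_coaction g); apply/(same rhoD _ (grouplike_rcomodule gP)) => // a.
  by rewrite (induced_regular _ (fun _ => erefl)) -coring_val_coact rhoDE.
- have L : linear (induced_coaction (entw_extension psi) rhoC) by exact: induced_klin.
  pose rhoD : {linear regular_rmod A -> (regular_rmod A ⊗ D)%type} :=
    HB.pack (induced_coaction (entw_extension psi) rhoC)
      (GRing.isLinear.Build _ _ _ _ _ L).
  by exists rhoD; apply/(same _ rhoC cleftP.1).
Qed.
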